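(* Let the Löwner differential equation $$\frac{dh}{dt}=\frac{2}{h-\lambda(t)},\qquad h(z,0)\equiv z,$$ with driving term $\lambda\in\mathrm{Lip}(1/2)$ generate slit maps $h(z,t):\mathbb H\setminus\gamma_t\to\mathbb H$, where $\gamma_t\cup\overline{\gamma_t}\cup\{\gamma(0)\}$ is an analytic curve which is mapped onto $[h^-(0,t),h^+(0,t)]$. Suppose that $$\lim_{t\to+0}\frac{\lambda(t)}{\sqrt t}=c,\qquad \lim_{t\to+0}\frac{h^+(0,t)}{\sqrt t}=b,\qquad c<b\le\frac{c+\sqrt{c^2+16}}{2}.$$ Let $a_2(t)$ be the coefficient in the expansion $h(z,t)=h^+(0,t)+a_2(t)z^2+a_3(t)z^3+\dots$, $t>0$, near the prime end at $z=0$ corresponding to $h^+(0,t)$. Then for every $\varepsilon>0$, $$\lim_{t\to+0}a_2(t)\,t^{\frac{2}{(b-c)^2}+\varepsilon}=0\qquad\text{and}\qquad \lim_{t\to+0}a_2(t)\,t^{\frac{2}{(b-c)^2}-\varepsilon}=\infty .$$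
   Context: $\mathbb H=\{z\in\mathbb C:\operatorname{Im}z>0\}$. The driving term $\lambda$ is a real-valued continuous function on an interval $[0,T]$; $\lambda\in\mathrm{Lip}(1/2)$ means that $|\lambda(t)-\lambda(s)|\le C|t-s|^{1/2}$ for some constant $C$. ''The equation generates slit maps'' means: there is a simple arc $t\mapsto\gamma(t)$, $t\in[0,T]$, with $\gamma(0)\in\mathbb R$ and $\gamma(t)\in\mathbb H$ for $t>0$, such that, writing $\gamma_t=\gamma((0,t])$ for the slit, the solution $h(\cdot,t)$ is the conformal map of $\mathbb H\setminus\gamma_t$ onto $\mathbb H$ with $h(z,t)=z+2t/z+O(1/z^2)$ near infinity. Standing normalization: $\gamma(0)=0$, hence $\lambda(0)=0$. $\overline{\gamma_t}$ is the reflection of $\gamma_t$ in the real axis. Analyticity: in the arc-length parameter $s$, $\gamma(s)=x(s)+iy(s)$ is analytic on $[0,S]$ with $x$ even and $y$ odd, so that $\gamma_t\cup\overline{\gamma_t}\cup\{0\}$ is an analytic curve symmetric with respect to $\mathbb R$. By Schwarz reflection $h(\cdot,t)$ extends to a conformal map of $\mathbb C\setminus(\gamma_t\cup\overline{\gamma_t}\cup\{0\})$ onto $\mathbb C\setminus I(t)$, where $I(t)=[h^-(0,t),h^+(0,t)]\subset\mathbb R$ is the image of the slit; $h^-(0,t)<h^+(0,t)$ are the images of the two prime ends at $z=0$ (left and right side of the slit), and both are solutions of the Löwner equation that are singular at $t=0$, with initial value $0$. For $t>0$, $h(\cdot,t)$ continues analytically across the slit near the (right) prime end at $z=0$ corresponding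 to $h^+(0,t)$, and there $h(z,t)=h^+(0,t)+a_2(t)z^2+a_3(t)z^3+\dots$ with $a_2(t)\ne0$. *)

(* Defs.v *)
From Stdlib Require Export Reals.
From Coquelicot Require Export Coquelicot.

Open Scope R_scope.

Definition upper_half_plane (z : C) : Prop := 0 < Im z.

Definition holomorphic_on (D : C -> Prop) (f : C -> C) : Prop :=
  forall z, D z -> ex_derive (K := C_AbsRing) (V := C_NormedModule) f z.

Definition conformal_map_onto (f : C -> C) (D E : C -> Prop) : Prop :=
  holomorphic_on D f /\
  (forall z, D z -> E (f z)) /\
  (forall z w, D z -> D w -> f z = f w -> z = w) /\
  (forall w, E w -> exists z, D z /\ f z = w).

Definition real_analytic_at (f : R -> R) (x : R) : Prop :=
  exists (a : nat -> R) (r : R), 0 < r /\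
    forall u, Rabs u < r -> is_pseries a u (f (x + u)).

Definition Lip_half (T : R) (lam : R -> R) : Prop :=
  exists K, forall s t, 0 <= s <= T -> 0 <= t <= T ->
    Rabs (lam t - lam s) <= K * sqrt (Rabs (t - s)).

(* gamma ((0, t]): the base point gamma 0 on the real line is not included *)
Definition slit (gamma : R -> C) (t : R) (z : C) : Prop :=
  exists s, 0 < s <= t /\ z = gamma s.

Definition slit_domain (gamma : R -> C) (t : R) (z : C) : Prop :=
  upper_half_plane z /\ ~ slit gamma t z.

Definition symmetric_slit (gamma : R -> C) (t : R) (z : C) : Prop :=
  slit gamma t z \/ slit gamma t (Cconj z) \/ z = gamma 0.

Definition simple_arc (T : R) (gamma : R -> C) : Prop :=
  continuous_on (fun t => 0 <= t <= T) gamma /\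
  (forall s t, 0 <= s <= T -> 0 <= t <= T -> gamma s = gamma t -> s = t) /\
  gamma 0 = RtoC 0 /\
  (forall t, 0 < t <= T -> upper_half_plane (gamma t)).

(* [sigma t] is the arc length of gamma on [0, t]: (X, Y) has unit speed.
   By parity, s |-> (X s, Y s) on [-S, S] runs through the whole symmetric
   curve. *)
Definition symmetric_analytic_curve (T : R) (gamma : R -> C) : Prop :=
  exists (S : R) (X Y sigma : R -> R),
    0 < S /\
    (forall s, - S <= s <= S -> real_analytic_at X s /\ real_analytic_at Y s) /\
    (forall s, - S <= s <= S -> X (- s) = X s /\ Y (- s) = - Y s) /\
    (forall s, - S <= s <= S -> Derive X s ^ 2 + Derive Y s ^ 2 = 1) /\
    sigma 0 = 0 /\ sigma T = S /\
    continuous_on (fun t => 0 <= t <= T) sigma /\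
    (forall s t, 0 <= s -> s < t -> t <= T -> sigma s < sigma t) /\
    (forall t, 0 <= t <= T -> gamma t = (X (sigma t), Y (sigma t))).

Definition hydrodynamic_normalization
    (gamma : R -> C) (h : C -> R -> C) (t : R) : Prop :=
  exists M rho : R, 0 < rho /\
    forall z, slit_domain gamma t z -> rho < Cmod z ->
      Cmod (h z t - (z + RtoC (2 * t) / z))%C <= M / Cmod z ^ 2.

(* The time derivative is taken within [0, T], hence one-sided at 0 and T, and
   only at times at which z has not been swallowed; [filterdiff] over
   [within _ (locally t)] is [is_derive] relative to a set. *)
Definition Loewner_equation (T : R) (lam : R -> R) (gamma : R -> C)
    (h : C -> R -> C) : Prop :=
  (forall z, upper_half_plane z -> h z 0 = z) /\
  (forall z t, 0 <= t <= T -> slit_domain gamma t z ->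
     filterdiff (K := R_AbsRing) (U := R_NormedModule) (V := C_R_NormedModule)
       (h z)
       (within (fun u => 0 <= u <= T) (locally t))
       (fun u => scal u (RtoC 2 / (h z t - RtoC (lam t)))%C)).

Definition generates_slit_maps (T : R) (lam : R -> R) (gamma : R -> C)
    (h : C -> R -> C) : Prop :=
  simple_arc T gamma /\
  Loewner_equation T lam gamma h /\
  (forall t, 0 <= t <= T ->
     conformal_map_onto (fun z => h z t) (slit_domain gamma t)
       upper_half_plane /\
     hydrodynamic_normalization gamma h t).

(* The points of H \ gamma_t lying to the right (left) of a point of the slit at
   the same height.  Only the germs of these sets at 0 are used.  Arc-length
   parametrization with X even and Y odd makes the slit leave 0 vertically, so
   near 0 it is a graph over the imaginary axis and these germs are the two
   sides of the slit, i.e. neighborhoods of the two prime ends at 0. *)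
Definition right_side (gamma : R -> C) (t : R) (z : C) : Prop :=
  slit_domain gamma t z /\
  exists s, 0 < s <= t /\ Im (gamma s) = Im z /\ Re (gamma s) < Re z.

Definition left_side (gamma : R -> C) (t : R) (z : C) : Prop :=
  slit_domain gamma t z /\
  exists s, 0 < s <= t /\ Im (gamma s) = Im z /\ Re z < Re (gamma s).

(* [p] is the image h^+(0,t), resp. h^-(0,t), of a prime end at 0 *)
Definition right_image (gamma : R -> C) (h : C -> R -> C) (t p : R) : Prop :=
  filterlim (fun z : C => h z t)
    (within (right_side gamma t) (locally (RtoC 0))) (locally (RtoC p)).

Definition left_image (gamma : R -> C) (h : C -> R -> C) (t p : R) : Prop :=
  filterlim (fun z : C => h z t)
    (within (left_side gamma t) (locally (RtoC 0))) (locally (RtoC p)).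

(* The Schwarz extension of h(.,t) maps the complement of the symmetric curve
   conformally onto the complement of the real segment [p, q]. *)
Definition symmetric_slit_mapped_onto (gamma : R -> C) (h : C -> R -> C)
    (t p q : R) : Prop :=
  exists g : C -> C,
    (forall z, slit_domain gamma t z -> g z = h z t) /\
    (forall z, ~ symmetric_slit gamma t z -> g (Cconj z) = Cconj (g z)) /\
    conformal_map_onto g (fun z => ~ symmetric_slit gamma t z)
      (fun w => ~ (Im w = 0 /\ p <= Re w <= q)).

(* h(z,t) = p + a_2 z^2 + a_3 z^3 + ... on the right side of the slit near 0;
   the sum of the series on the full disc is the analytic continuation. *)
Definition right_expansion (gamma : R -> C) (h : C -> R -> C) (t p : R)
    (a : nat -> C) : Prop :=
  a 0%nat = RtoC p /\ a 1%nat = RtoC 0 /\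
  exists r : R, 0 < r /\
    forall z, right_side gamma t z -> Cmod z < r ->
      is_pseries (K := C_AbsRing) (V := C_NormedModule) a z (h z t).

(* Main.v *)
Require Import Defs.
From Stdlib Require Import Lra Lia Psatz Classical.

(* With z = r (1 + i), write h(z, t) = u + i v.  On this ray v = Im h(z, t) is
   2 a_2(t) r^2 + O(r^3), and the Loewner equation gives
   (log v)' = - 2 / |h - lambda|^2.  As r -> 0, h(z, t) tends to h^+(0,t), and
   h^+(0,t) - lambda(t) ~ (b - c) sqrt t, so up to epsilon (log v)' is
   - 2 / ((b - c)^2 t).  Hence v t^al is monotone in t for al slightly above or
   below 2 / (b - c)^2; dividing by r^2 and letting r -> 0 the same holds for
   a_2(t) t^al.  That a_2(t) is real and positive follows from Im h > 0: the
   leading term of h(z, t) - h^+(0,t) maps the first quadrant into the closed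
   upper half-plane. *)

(** * Geometry of the slit near its base point *)

(** The monotonicity is established for v at a fixed r, and only an inequality between two times is
    passed to the limit r -> 0. Thus no regularity of a_2 in t is required and no expansion is
    differentiated in time. The obstacle is uniformity: h(z, s) tends to h^+(0,s) for each s
    separately, whereas integrating (log v)' between two times needs |h - lambda| under control at
    all intermediate times for one and the same r. The equation itself supplies what is missing. At
    distance at least m from lambda the real part moves with speed at most 2/m, whatever v and r
    are, and v decreases, so its smallness at the initial time suffices. That a_2(t) does not vanish
    is derived, not assumed: a leading power of order at least 3 opens the quadrant too wide to fit
    into the half-plane, and if every coefficient after the constant term vanished, h would be
    real. *)

Definition clamp (p q s : R) : R := Rmax p (Rmin s q).

Lemma clamp_id (p q s : R) : p <= s <= q -> clamp p q s = s.
Proof.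
  intros H; unfold clamp; rewrite Rmin_left, Rmax_right; lra.
Qed.

Lemma clamp_bounds (p q s : R) : p <= q -> p <= clamp p q s <= q.
Proof.
  intros H; unfold clamp, Rmax, Rmin.
  destruct (Rle_dec s q), (Rle_dec p _); lra.
Qed.

(** [clamp] is 1-Lipschitz with values in [p, q]. Composing with it turns continuity relative to the
    interval into two-sided continuity, the form in which the intermediate and extreme value
    theorems are applied. *)
Lemma continuous_on_clamp {V : UniformSpace} (f : R -> V) (p q : R) :
  p <= q -> continuous_on (fun s => p <= s <= q) f ->
  forall x : R, continuous (fun s => f (clamp p q s)) x.
Proof.
  intros Hpq Hf x.
  apply (filterlim_comp _ _ _ (clamp p q) f _
    (within (fun s => p <= s <= q) (locally (clamp p q x)))).
  2: now apply Hf, clamp_bounds.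
  intros P [d Hd].
  exists d; intros y Hy.
  apply Hd; [|now apply clamp_bounds].
  revert Hy; unfold ball; simpl; unfold AbsRing_ball, abs, minus, plus, opp; simpl.
  intros Hy; eapply Rle_lt_trans; [|exact Hy].
  unfold clamp, Rmax, Rmin.
  destruct (Rle_dec x q), (Rle_dec y q);
    repeat destruct (Rle_dec p _); unfold Rabs; repeat destruct Rcase_abs; lra.
Qed.

Lemma continuous_on_real_clamp (f : R -> R) (p q : R) :
  p <= q -> continuous_on (fun s => p <= s <= q) f ->
  continuity (fun s => f (clamp p q s)).
Proof.
  intros Hpq Hf x; apply continuity_pt_filterlim.
  now apply (continuous_on_clamp f).
Qed.

Lemma continuous_on_comp {U V : UniformSpace} (D : R -> Prop) (f : R -> U)
    (g : U -> V) :
  continuous_on D f -> (forall x, continuous g x) ->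
  continuous_on D (fun s => g (f s)).
Proof.
  intros Hf Hg x Hx; eapply filterlim_comp; [now apply Hf|apply Hg].
Qed.

Lemma Im_continuous (z : C) : continuous Im z.
Proof. apply (continuous_snd (fst z) (snd z)). Qed.

Lemma IVT_on (f : R -> R) (p q y : R) :
  p <= q -> continuous_on (fun s => p <= s <= q) f ->
  f p <= y <= f q -> exists x, p <= x <= q /\ f x = y.
Proof.
  intros Hpq Hf Hy.
  destruct (IVT_gen (fun s => f (clamp p q s)) p q y) as [x [Hx Hxy]].
  - now apply continuous_on_real_clamp.
  - rewrite !clamp_id, Rmin_left, Rmax_right; lra.
  - rewrite Rmin_left, Rmax_right in Hx by lra.
    exists x; split; [lra|]; now rewrite clamp_id in Hxy by lra.
Qed.

Lemma continuous_on_sub {V : UniformSpace} (D E : R -> Prop) (f : R -> V) :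
  (forall x, E x -> D x) -> continuous_on D f -> continuous_on E f.
Proof.
  intros HED Hf x Hx P HP.
  generalize (Hf x (HED x Hx) P HP); unfold filtermap, within.
  apply filter_imp; intros y Hy HE; apply Hy; now apply HED.
Qed.

Lemma real_analytic_ex_derive (f : R -> R) (x : R) :
  real_analytic_at f x -> ex_derive f x.
Proof.
  intros [a [r [Hr Ha]]].
  (* The series converges at r / 2, so its terms tend to 0 there, which is impossible outside the
     disk of convergence; hence the radius is at least r / 2. *)
  assert (HCV : Rbar_lt (Rabs 0) (CV_radius a)).
  { apply Rbar_lt_le_trans with (Rabs (r / 2)).
    - simpl; rewrite Rabs_R0, Rabs_pos_eq; lra.
    - apply Rbar_not_lt_le; intros Hlt.
      apply (CV_disk_outside a (r / 2) Hlt).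
      apply ex_series_lim_0.
      exists (f (x + r / 2)).
      assert (Hs : is_pseries a (r / 2) (f (x + r / 2))).
      { apply Ha; rewrite Rabs_pos_eq; lra. }
      apply is_pseries_R in Hs.
      eapply is_series_ext; [|exact Hs]; intros n; simpl; ring. }
  assert (Hd : ex_derive (fun y => PSeries a (y - x)) x).
  { apply (ex_derive_comp (PSeries a) (fun y => y - x)).
    - eexists; apply is_derive_PSeries.
      replace (x - x) with 0 by ring; exact HCV.
    - auto_derive; trivial. }
  eapply ex_derive_ext_loc; [|exact Hd].
  exists (mkposreal r Hr); intros y Hy.
  apply is_pseries_unique.
  replace y with (x + (y - x)) at 2 by ring.
  apply Ha, Hy.
Qed.

Lemma is_derive_remainder (f : R -> R) (l e : R) :
  is_derive f 0 l -> 0 < e ->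
  exists d, 0 < d /\
    forall x, Rabs x < d -> Rabs (f x - f 0 - l * x) <= e * Rabs x.
Proof.
  intros [_ Hf] He.
  destruct (Hf 0 (fun P HP => HP) (mkposreal e He)) as [d Hd].
  exists d; split; [apply cond_pos|]; intros x Hx.
  assert (Hb : ball 0 d x).
  { unfold ball; simpl; unfold AbsRing_ball, abs, minus, plus, opp; simpl.
    replace (x + - 0) with x by ring; exact Hx. }
  generalize (Hd x Hb); unfold norm, minus, plus, opp, scal; simpl.
  unfold abs, mult; simpl; unfold mult; simpl.
  replace (f x + - f 0 + - ((x + - 0) * l)) with (f x - f 0 - l * x) by ring.
  replace (x + - 0) with x by ring; trivial.
Qed.

(** Evenness of X gives X'(0) = 0, so unit speed gives Y'(0) = 1 or -1; the value -1 would send the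
    slit into the lower half-plane. Hence Re is o(Im) along the slit. *)
Lemma tangent_vertical (T : R) (gamma : R -> C) :
  0 < T -> simple_arc T gamma -> symmetric_analytic_curve T gamma ->
  forall e, 0 < e -> exists d, 0 < d <= T /\
    forall s, 0 <= s <= d -> Rabs (Re (gamma s)) <= e * Im (gamma s).
Proof.
  intros HT [_ [_ [Hg0 Hup]]].
  intros [S [X [Y [sg [HS [Han [Hpar [Hunit [Hs0 [HsT [Hsc [Hsm Hg]]]]]]]]]]]].
  intros e He.
  assert (H0S : - S <= 0 <= S) by lra.
  assert (HX : is_derive X 0 (Derive X 0)).
  { apply Derive_correct, real_analytic_ex_derive, Han, H0S. }
  assert (HY : is_derive Y 0 (Derive Y 0)).
  { apply Derive_correct, real_analytic_ex_derive, Han, H0S. }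
  assert (HX0 : X 0 = 0 /\ Y 0 = 0).
  { generalize Hg0; rewrite Hg, Hs0 by lra; intros E; injection E; tauto. }
  destruct HX0 as [HX0 HY0].
  assert (Hsg : forall d, 0 < d -> exists r, 0 < r <= T /\
      forall s, 0 < s <= r -> 0 < sg s < d /\ sg s <= S).
  { intros d Hd.
    destruct (Hsc 0 (conj (Rle_refl 0) (Rlt_le _ _ HT)) (ball 0 d)) as [r Hr].
    { exists (mkposreal d Hd); rewrite Hs0; trivial. }
    exists (Rmin (r / 2) T); split.
    - split; [|apply Rmin_r]; apply Rmin_glb_lt; [|lra].
      generalize (cond_pos r); lra.
    - intros s [Hs Hs'].
      assert (Hs1 : s <= r / 2 /\ s <= T).
      { split; (eapply Rle_trans; [exact Hs'|]); [apply Rmin_l|apply Rmin_r]. }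
      assert (Hs2 : 0 < sg s).
      { rewrite <- Hs0; apply Hsm; lra. }
      repeat split; trivial.
      + assert (Hb : ball 0 d (sg s)).
        { apply Hr; [|lra].
          unfold ball; simpl; unfold AbsRing_ball, abs, minus, plus, opp; simpl.
          rewrite Rabs_pos_eq; generalize (cond_pos r); lra. }
        revert Hb; unfold ball; simpl.
        unfold AbsRing_ball, abs, minus, plus, opp; simpl.
        rewrite Rabs_pos_eq; lra.
      + rewrite <- HsT; destruct (Req_dec s T) as [->|]; [lra|].
        apply Rlt_le, Hsm; lra. }
  assert (HdX : Derive X 0 = 0).
  { assert (HX' : is_derive (fun s => X (- s)) 0 (- Derive X 0)).
    { auto_derive; rewrite Ropp_0; [now exists (Derive X 0)|].
      change (fun x => X x) with X; ring. }
    assert (HX2 : is_derive (fun s => X (- s)) 0 (Derive X 0)).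
    { eapply is_derive_ext_loc; [|exact HX].
      exists (mkposreal S HS); intros s Hs.
      symmetry; apply Hpar; revert Hs; unfold ball; simpl.
      unfold AbsRing_ball, abs, minus, plus, opp; simpl.
      intros Hs; apply Rabs_def2 in Hs; lra. }
    apply is_derive_unique in HX'; apply is_derive_unique in HX2; lra. }
  assert (HdY : Derive Y 0 = 1).
  { generalize (Hunit 0 H0S); rewrite HdX; intros Hu.
    destruct (Req_dec (Derive Y 0) 1) as [|Hne]; [trivial|exfalso].
    assert (Hm : Derive Y 0 = -1) by nra.
    destruct (is_derive_remainder Y _ (1 / 2) HY) as [d [Hd Hd']]; [lra|].
    destruct (Hsg d Hd) as [r [Hr Hr']].
    destruct (Hr' r) as [Hr1 Hr2]; [lra|].
    generalize (Hup r Hr); unfold upper_half_plane; rewrite Hg by lra; simpl.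
    generalize (Hd' (sg r)); rewrite Hm, HY0, (Rabs_pos_eq (sg r)) by lra.
    intros Hb; specialize (Hb (proj2 Hr1)).
    apply Rabs_le_between in Hb; lra. }
  rewrite HdX in HX; rewrite HdY in HY.
  (* The two tolerances give Y >= sigma / 2 and |X| <= e sigma / 2, hence |X| <= e Y. *)
  destruct (is_derive_remainder Y _ (1 / 2) HY) as [d1 [Hd1 Hd1']]; [lra|].
  destruct (is_derive_remainder X _ (e / 2) HX) as [d2 [Hd2 Hd2']]; [lra|].
  destruct (Hsg (Rmin d1 d2)) as [r [Hr Hr']]; [now apply Rmin_glb_lt|].
  exists r; split; [trivial|]; intros s Hs.
  destruct (Req_dec s 0) as [->|Hs'].
  { rewrite Hg0; simpl; rewrite Rabs_R0; lra. }
  destruct (Hr' s) as [Hs1 Hs2]; [lra|].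
  rewrite Hg by lra; simpl.
  generalize (Rmin_l d1 d2) (Rmin_r d1 d2); intros Hm1 Hm2.
  generalize (Hd1' (sg s)) (Hd2' (sg s)).
  rewrite HX0, HY0, (Rabs_pos_eq (sg s)) by lra; intros H1 H2.
  specialize (H1 ltac:(lra)); specialize (H2 ltac:(lra)).
  apply Rabs_le_between in H1.
  replace (X (sg s) - 0 - 0 * sg s) with (X (sg s)) in H2 by ring.
  nra.
Qed.

(** Near 0 the slit lies in a cone about the imaginary axis with half the opening of the ray, so a
    slit point at the same height is strictly to the left of the ray. The rest of the slit stays
    above a positive height, out of reach of a short piece of the ray. *)
Lemma ray_in_right_side (T : R) (gamma : R -> C) (x y : R) :
  0 < T -> simple_arc T gamma -> symmetric_analytic_curve T gamma ->
  0 < x -> 0 < y ->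
  forall t, 0 < t <= T -> exists d, 0 < d /\
    forall r, 0 < r < d -> right_side gamma t (r * x, r * y).
Proof.
  intros HT Harc Han Hx Hy t Ht.
  destruct (tangent_vertical T gamma HT Harc Han (x / (2 * y)))
    as [d0 [Hd0 Htan0]].
  { apply Rdiv_lt_0_compat; lra. }
  destruct Harc as [Hcont [Hinj [Hg0 Hup]]].
  assert (HIm : continuous_on (fun s => 0 <= s <= T) (fun s => Im (gamma s))).
  { apply continuous_on_comp; [trivial|apply Im_continuous]. }
  pose (d := Rmin d0 t).
  assert (Hd : 0 < d <= t /\ d <= d0).
  { unfold d; repeat split; [apply Rmin_glb_lt; lra|apply Rmin_r|apply Rmin_l]. }
  assert (Htan : forall s, 0 <= s <= d ->
      2 * y * Rabs (Re (gamma s)) <= x * Im (gamma s)).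
  { intros s Hs; generalize (Htan0 s ltac:(lra)); intros H.
    replace (x * Im (gamma s)) with (2 * y * (x / (2 * y) * Im (gamma s)))
      by (field; lra).
    apply Rmult_le_compat_l; lra. }
  (* [m] is where the slit is lowest outside the cone region; ray points below that height can only
     meet the part of the slit inside the cone. *)
  destruct (continuity_ab_min (fun s => Im (gamma (clamp 0 T s))) d T)
    as [m [Hm Hm']]; [lra| |].
  { intros c _.
    now apply (continuous_on_real_clamp (fun s => Im (gamma s))); [lra|]. }
  assert (Hmpos : 0 < Im (gamma m)) by (apply Hup; lra).
  exists (Im (gamma m) / y); split; [apply Rdiv_lt_0_compat; lra|].
  intros r Hr.
  assert (Hry : 0 < r * y < Im (gamma m)).
  { split; [apply Rmult_lt_0_compat; lra|].
    apply (Rmult_lt_reg_r (/ y)); [apply Rinv_0_lt_compat; lra|].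
    rewrite Rmult_assoc, Rinv_r; unfold Rdiv in Hr; lra. }
  assert (Hmin : forall s, d <= s <= T -> Im (gamma m) <= Im (gamma s)).
  { intros s Hs; generalize (Hm s Hs); now rewrite !clamp_id by lra. }
  repeat split.
  - unfold upper_half_plane; simpl; lra.
  - intros [s [Hs Hs']].
    destruct (Rle_dec s d) as [Hsd|Hsd].
    + generalize (Htan s ltac:(lra)); rewrite <- Hs'; simpl.
      rewrite Rabs_pos_eq by (apply Rmult_le_pos; lra).
      intros H; assert (0 < r * x * y) by (repeat apply Rmult_lt_0_compat; lra).
      nra.
    + generalize (Hmin s ltac:(lra)); rewrite <- Hs'; simpl; lra.
  (* The height of the slit runs continuously from 0 to at least [Im (gamma m)], so it takes the
     value r y before time d, where the cone bound applies. *)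
  - destruct (IVT_on (fun s => Im (gamma s)) 0 d (r * y)) as [s [Hs Hs']].
    + lra.
    + eapply continuous_on_sub; [|exact HIm]; simpl; intros; lra.
    + rewrite Hg0; simpl; generalize (Hmin d ltac:(lra)); lra.
    + assert (Hs0 : s <> 0).
      { intros ->; revert Hs'; rewrite Hg0; simpl; lra. }
      exists s; repeat split; simpl; try lra; try exact Hs'.
      generalize (Htan s Hs); rewrite Hs'; intros H.
      generalize (Rle_abs (Re (gamma s))); intros H'.
      assert (0 < r * x * y) by (repeat apply Rmult_lt_0_compat; lra).
      apply (Rmult_lt_reg_l (2 * y)); nra.
Qed.

(** * Leading terms of the expansion at the prime end *)

Lemma pow_n_Cpow (z : C) (n : nat) : pow_n (K := C_Ring) z n = (z ^ n)%C.
Proof.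
  induction n as [|n IH]; [reflexivity|].
  now simpl; rewrite IH.
Qed.

Lemma is_pseries_C_partial_sums (a : nat -> C) (z l : C) (e : R) :
  is_pseries (K := C_AbsRing) (V := C_NormedModule) a z l -> 0 < e ->
  exists N, forall n, (N <= n)%nat ->
    Cmod (sum_n (fun k => a k * z ^ k)%C n - l) < e.
Proof.
  intros H He.
  apply filterlim_locally_ball_norm with (eps := mkposreal e He) in H.
  destruct H as [N HN]; exists N; intros n Hn.
  generalize (HN n Hn); unfold ball_norm; simpl.
  erewrite sum_n_ext; [intros Hb; exact Hb|].
  intros k; rewrite pow_n_Cpow; apply Cmult_comm.
Qed.

(** A term is the difference of two consecutive partial sums, and these are bounded; the added 1
    only makes the bound strictly positive. *)
Lemma is_pseries_C_bounded_terms (a : nat -> C) (z l : C) :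
  is_pseries (K := C_AbsRing) (V := C_NormedModule) a z l ->
  exists M, 0 < M /\ forall n, Cmod (a n * z ^ n) <= M.
Proof.
  intros H.
  destruct (filterlim_bounded _ (ex_intro _ l H)) as [M HM'].
  assert (HM : forall n, Cmod (sum_n (fun k => a k * z ^ k)%C n) <= M).
  { intros n; eapply Rle_trans; [|exact (HM' n)]; apply Req_le.
    apply (f_equal Cmod), (sum_n_ext (G := C_AbelianMonoid)).
    intros k; rewrite Cmult_comm, <- pow_n_Cpow; reflexivity. }
  assert (HM0 : 0 <= M).
  { eapply Rle_trans; [apply Cmod_ge_0|apply (HM 0%nat)]. }
  exists (M + M + 1); split; [lra|]; intros [|n].
  - generalize (HM 0%nat); rewrite sum_O; unfold norm; simpl; lra.
  - generalize (HM n) (HM (S n)); rewrite sum_Sn; unfold norm, plus; simpl.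
    set (s := sum_n _ n); set (u := (a (S n) * _)%C); intros H1 H2.
    replace u with ((s + u) + - s)%C by ring.
    eapply Rle_trans; [apply Cmod_triangle|]; rewrite Cmod_opp.
    change (Cmod (s + u) <= M) in H2; change (Cmod s <= M) in H1; lra.
Qed.

(** Boundedness of the terms at z1 bounds the n-th term at z by M (|z| / |z1|)^n. For |z| <= |z1| /
    2 the tail after order k is dominated by a geometric series of ratio 1/2, which costs a factor
    2. What matters is that B is the same for all such z. *)
Lemma pseries_C_remainder (a : nat -> C) (z1 l1 : C) (k : nat) :
  z1 <> 0 -> is_pseries (K := C_AbsRing) (V := C_NormedModule) a z1 l1 ->
  (1 <= k)%nat -> (forall j, (1 <= j < k)%nat -> a j = 0) ->
  exists B, 0 < B /\ forall z l,
    is_pseries (K := C_AbsRing) (V := C_NormedModule) a z l ->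
    Cmod z <= Cmod z1 / 2 ->
    Cmod (l - a 0%nat - a k * z ^ k) <= B * Cmod z ^ S k.
Proof.
  intros Hz1 H1 Hk Ha.
  destruct (is_pseries_C_bounded_terms _ _ _ H1) as [M [HM0 HM]].
  assert (Hm1 : 0 < Cmod z1) by now apply Cmod_gt_0.
  pose (q := / Cmod z1).
  assert (Hq : 0 < q) by now apply Rinv_0_lt_compat.
  exists (M * q ^ S k * 2); split.
  { assert (0 < q ^ S k) by now apply pow_lt.
    apply Rmult_lt_0_compat; [apply Rmult_lt_0_compat|]; lra. }
  intros z l Hl Hz.
  assert (Hqz : 0 <= q * Cmod z <= 1 / 2).
  { split; [apply Rmult_le_pos; [lra|apply Cmod_ge_0]|].
    apply (Rmult_le_reg_l (Cmod z1)); [trivial|].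
    unfold q; rewrite <- Rmult_assoc, Rinv_r; lra. }
  assert (Hterm : forall n, Cmod (a n * z ^ n) <= M * (q * Cmod z) ^ n).
  { intros n; generalize (HM n); rewrite !Cmod_mult, !Cmod_pow; intros Hn.
    replace (Cmod (a n) * Cmod z ^ n)
      with (Cmod (a n) * Cmod z1 ^ n * (q * Cmod z) ^ n).
    - apply Rmult_le_compat_r; [apply pow_le; lra|trivial].
    - rewrite Rpow_mult_distr; unfold q; rewrite pow_inv; field.
      apply pow_nonzero; lra. }
  pose (s := sum_n (G := C_AbelianMonoid) (fun j => a j * z ^ j)%C).
  assert (Hsk : forall n, (n < k)%nat -> s n = a 0%nat).
  { induction n as [|n IH]; intros Hn; unfold s.
    - rewrite sum_O; simpl; ring.
    - rewrite sum_Sn; fold s; rewrite IH, (Ha (S n)) by lia.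
      unfold plus; simpl; ring. }
  (* [2 * (1 - (1 / 2) ^ m)] is the sum of the first m terms of 1 + 1/2 + 1/4 + ... *)
  assert (Hs : forall m, Cmod (s (k + m)%nat - a 0%nat - a k * z ^ k)
      <= M * (q * Cmod z) ^ S k * (2 * (1 - (1 / 2) ^ m))).
  { induction m as [|m IH].
    - rewrite Nat.add_0_r; destruct k as [|k']; [lia|].
      unfold s; rewrite sum_Sn; fold s; rewrite Hsk by lia.
      unfold plus; simpl Hierarchy.AbelianMonoid.plus.
      match goal with |- Cmod ?u <= _ => replace u with (RtoC 0) end.
      + rewrite Cmod_0, pow_O; lra.
      + unfold plus; simpl; ring.
    - set (w := (a (S (k + m)) * z ^ S (k + m))%C).
      assert (E : s (k + S m)%nat = (s (k + m)%nat + w)%C).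
      { rewrite Nat.add_succ_r; unfold s; rewrite sum_Sn; reflexivity. }
      assert (Hw : Cmod w <= M * (q * Cmod z) ^ S k * (1 / 2) ^ m).
      { eapply Rle_trans; [apply Hterm|].
        rewrite Rmult_assoc; apply Rmult_le_compat_l; [lra|].
        rewrite <- Nat.add_succ_l, pow_add.
        apply Rmult_le_compat_l; [apply pow_le; lra|].
        apply pow_incr; lra. }
      rewrite E.
      replace (s (k + m)%nat + w - a 0%nat - a k * z ^ k)%C
        with ((s (k + m)%nat - a 0%nat - a k * z ^ k) + w)%C by ring.
      eapply Rle_trans; [apply Cmod_triangle|].
      change ((1 / 2) ^ S m) with (1 / 2 * (1 / 2) ^ m); lra. }
  apply le_epsilon; intros e He.
  destruct (is_pseries_C_partial_sums _ _ _ _ Hl He) as [N HN].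
  specialize (HN (k + N)%nat ltac:(lia)); fold s in HN.
  specialize (Hs N).
  replace (l - a 0%nat - a k * z ^ k)%C
    with ((s (k + N)%nat - a 0%nat - a k * z ^ k) + - (s (k + N)%nat - l))%C
    by ring.
  eapply Rle_trans; [apply Cmod_triangle|]; rewrite Cmod_opp.
  assert (Hh : 0 <= (1 / 2) ^ N) by (apply pow_le; lra).
  assert (Hqk : 0 <= M * (q * Cmod z) ^ S k).
  { apply Rmult_le_pos; [lra|apply pow_le; lra]. }
  replace (M * q ^ S k * 2 * Cmod z ^ S k) with (M * (q * Cmod z) ^ S k * 2)
    by (rewrite Rpow_mult_distr; ring).
  assert (M * (q * Cmod z) ^ S k * (2 * (1 - (1 / 2) ^ N))
    <= M * (q * Cmod z) ^ S k * 2) by (apply Rmult_le_compat_l; lra).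
  change (Cmod (s (k + N)%nat - l) < e) in HN; lra.
Qed.

Lemma Cpow_polar (th : R) (k : nat) :
  Cpow (cos th, sin th) k = (cos (INR k * th), sin (INR k * th)).
Proof.
  induction k as [|k IH].
  - simpl; rewrite Rmult_0_l, cos_0, sin_0; reflexivity.
  - rewrite Cpow_S, IH, S_INR, Rmult_plus_distr_r, Rmult_1_l, cos_plus, sin_plus.
    unfold Cmult; simpl; f_equal; ring.
Qed.

Lemma Im_le_Cmod (z : C) : Rabs (Im z) <= Cmod z.
Proof. eapply Rle_trans; [apply Rmax_r|apply Rmax_Cmod]. Qed.

(** * Power series with values in the upper half-plane along rays of the first quadrant *)

Section Quadrant.

(** This is the slit map at one fixed time. [HD] provides a segment of each single ray whose length
    depends on the ray, so all estimates are made ray by ray. *)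
Variables (D : C -> Prop) (f : C -> C) (a : nat -> C) (p r0 : R).
Hypothesis HD : forall x y, 0 < x -> 0 < y ->
  exists d, 0 < d /\ forall r, 0 < r < d -> D (r * x, r * y).
Hypothesis Hf : forall z, D z -> 0 < Im (f z).
Hypothesis Ha0 : a 0%nat = RtoC p.
Hypothesis Hr0 : 0 < r0.
Hypothesis Hexp : forall z, D z -> Cmod z < r0 ->
  is_pseries (K := C_AbsRing) (V := C_NormedModule) a z (f z).

Lemma ray_small (x y m : R) :
  0 < x -> 0 < y -> 0 < m -> exists d, 0 < d /\
    forall r, 0 < r < d -> D (r * x, r * y) /\ Cmod (r * x, r * y) < m.
Proof.
  intros Hx Hy Hm; destruct (HD x y Hx Hy) as [d [Hd Hd']].
  assert (Hxy : 0 < Cmod (x, y)).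
  { apply Cmod_gt_0; intros E; injection E; lra. }
  exists (Rmin d (m / Cmod (x, y))); split.
  { apply Rmin_glb_lt; [|apply Rdiv_lt_0_compat]; trivial. }
  intros r Hr.
  generalize (Rmin_l d (m / Cmod (x, y))) (Rmin_r d (m / Cmod (x, y))).
  intros Hl Hr'; split; [apply Hd'; lra|].
  replace ((r * x, r * y) : C) with (RtoC r * (x, y))%C
    by (unfold Cmult, RtoC; simpl; f_equal; ring).
  rewrite Cmod_mult, Cmod_R, Rabs_pos_eq by lra.
  replace m with (m / Cmod (x, y) * Cmod (x, y)) by (field; lra).
  apply Rmult_lt_compat_r; lra.
Qed.

Lemma leading_term_on_ray (k : nat) (x y : R) :
  (1 <= k)%nat -> (forall j, (1 <= j < k)%nat -> a j = 0) ->
  0 < x -> 0 < y ->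
  exists B d, 0 < B /\ 0 < d /\ forall r, 0 < r < d ->
    D (r * x, r * y) /\
    Rabs (Im (f (r * x, r * y)) - Im (a k * (x, y) ^ k)%C * r ^ k)
      <= B * r ^ S k.
Proof.
  intros Hk Ha Hx Hy.
  (* The remainder bound is anchored at a nonzero point of convergence; a short diagonal point of
     [D] serves. *)
  destruct (ray_small 1 1 r0) as [d1 [Hd1 Hd1']]; try lra.
  destruct (Hd1' (d1 / 2)) as [HDz Hz]; [lra|].
  set (z1 := (d1 / 2 * 1, d1 / 2 * 1)) in *.
  assert (Hz1 : z1 <> RtoC 0) by (intros E; injection E; lra).
  destruct (pseries_C_remainder a z1 _ k Hz1 (Hexp z1 HDz Hz) Hk Ha)
    as [B [HB HB']].
  assert (Hm1 : 0 < Cmod z1) by now apply Cmod_gt_0.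
  destruct (ray_small x y (Rmin r0 (Cmod z1 / 2)) Hx Hy) as [d [Hd Hd']].
  { apply Rmin_glb_lt; lra. }
  assert (Hxy : 0 < Cmod (x, y)).
  { apply Cmod_gt_0; intros E; injection E; lra. }
  exists (B * Cmod (x, y) ^ S k), d; split; [|split; [trivial|]].
  { apply Rmult_lt_0_compat; [trivial|now apply pow_lt]. }
  intros r Hr; destruct (Hd' r Hr) as [HDr Hrm]; split; [trivial|].
  generalize (Rmin_l r0 (Cmod z1 / 2)) (Rmin_r r0 (Cmod z1 / 2)); intros H1 H2.
  generalize (HB' _ _ (Hexp _ HDr ltac:(lra)) ltac:(lra)).
  set (w := f _).
  replace ((r * x, r * y) : C) with (RtoC r * (x, y))%C
    by (unfold Cmult, RtoC; simpl; f_equal; ring).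
  rewrite Cmod_mult, Cmod_R, Rabs_pos_eq, Rpow_mult_distr, Cpow_mult_l,
    <- RtoC_pow by lra.
  intros H; eapply Rle_trans; [|eapply Rle_trans; [exact H|apply Req_le; ring]].
  eapply Rle_trans; [|apply Im_le_Cmod]; apply Req_le, f_equal.
  rewrite Ha0; unfold Cmult, Cminus, Cplus, Copp, RtoC; unfold Im; simpl; ring.
Qed.

Lemma leading_term_ge_0 (k : nat) (x y : R) :
  (1 <= k)%nat -> (forall j, (1 <= j < k)%nat -> a j = 0) ->
  0 < x -> 0 < y -> 0 <= Im (a k * (x, y) ^ k)%C.
Proof.
  intros Hk Ha Hx Hy.
  destruct (leading_term_on_ray k x y Hk Ha Hx Hy) as [B [d [HB [Hd H]]]].
  set (L := Im _) in *.
  destruct (Rle_or_lt 0 L) as [|HL]; [trivial|exfalso].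
  (* At this r the error B r^(k+1) is at most - L r^k, which would force Im f <= 0. *)
  pose (r := Rmin (d / 2) (- L / B)).
  assert (Hr : 0 < r).
  { apply Rmin_glb_lt; [lra|apply Rdiv_lt_0_compat; lra]. }
  assert (Hrd : r <= d / 2) by apply Rmin_l.
  assert (HrB : r <= - L / B) by apply Rmin_r.
  destruct (H r) as [HDr Hle]; [lra|].
  apply Rabs_le_between in Hle; generalize (Hf _ HDr); intros Him.
  assert (Hrk : 0 < r ^ k) by now apply pow_lt.
  assert (B * r <= - L).
  { apply (Rmult_le_compat_l B) in HrB; [|lra].
    replace (B * (- L / B)) with (- L) in HrB by (field; lra); trivial. }
  assert (B * r ^ S k <= - L * r ^ k).
  { simpl; rewrite <- Rmult_assoc; apply Rmult_le_compat_r; lra. }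
  lra.
Qed.

(* [z ^ k] with [k >= 3] opens the quadrant to an angle of at least 3 pi / 2,
   so its image contains two opposite rays in two different directions. *)
Lemma leading_coefficient_eq_0 (k : nat) :
  (3 <= k)%nat -> (forall j, (1 <= j < k)%nat -> a j = 0) -> a k = 0.
Proof.
  intros Hk Ha.
  assert (HPI := PI_RGT_0).
  assert (Hk3 : 3 <= INR k) by (apply le_INR in Hk; simpl in Hk; lra).
  assert (Hphi : forall phi, 0 < phi < 3 * (PI / 2) ->
      0 <= Re (a k) * sin phi + Im (a k) * cos phi).
  { intros phi Hphi.
    assert (Hth : 0 < phi / INR k < PI / 2).
    { split; [apply Rdiv_lt_0_compat; lra|].
      apply (Rmult_lt_reg_r (INR k)); [lra|].
      unfold Rdiv at 1; rewrite Rmult_assoc, Rinv_l by lra; nra. }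
    generalize (leading_term_ge_0 k (cos (phi / INR k)) (sin (phi / INR k))
      ltac:(lia) Ha (cos_gt_0 (phi / INR k) ltac:(lra) ltac:(lra))
      (sin_gt_0 (phi / INR k) ltac:(lra) ltac:(lra))).
    rewrite Cpow_polar.
    replace (INR k * (phi / INR k)) with phi by (field; lra).
    unfold Cmult; simpl; trivial. }
  (* Both phi and phi + PI are admissible, and the expression changes sign between them, so it is
     zero. Two distinct angles then give independent linear equations for the real and imaginary
     parts. *)
  assert (Hopp : forall phi, 0 < phi < PI / 2 ->
      Re (a k) * sin phi + Im (a k) * cos phi = 0).
  { intros phi Hp; generalize (Hphi phi ltac:(lra)) (Hphi (phi + PI) ltac:(lra)).
    rewrite neg_sin, neg_cos; lra. }
  generalize (Hopp (PI / 4) ltac:(lra)) (Hopp (PI / 3) ltac:(lra)).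
  rewrite sin_PI4, cos_PI4, sin_PI3, cos_PI3; intros H4 H3.
  assert (Hs2 : 0 < 1 / sqrt 2).
  { apply Rdiv_lt_0_compat; [lra|apply sqrt_lt_R0; lra]. }
  assert (Hs3 : 1 < sqrt 3) by (rewrite <- sqrt_1; apply sqrt_lt_1; lra).
  assert (Hsum : Re (a k) = - Im (a k)).
  { apply (Rmult_eq_reg_r (1 / sqrt 2)); lra. }
  assert (Him : Im (a k) = 0).
  { rewrite Hsum in H3; apply (Rmult_eq_reg_r (1 - sqrt 3)); lra. }
  apply injective_projections; simpl; unfold Re, Im in *; lra.
Qed.

Hypothesis Ha1 : a 1%nat = 0.

(** If a_2 vanished, each later coefficient would in turn become the leading one and vanish as well,
    leaving f equal to the real constant p on [D] near 0. *)
Lemma second_coefficient_neq_0 : a 2%nat <> 0.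
Proof.
  intros Ha2.
  assert (Hall : forall n j, (1 <= j <= n)%nat -> a j = 0).
  { induction n as [|n IH]; intros j Hj; [lia|].
    destruct (Nat.le_gt_cases j n) as [Hjn|Hjn]; [apply IH; lia|].
    destruct j as [|[|[|j]]]; [lia|trivial|trivial|].
    apply leading_coefficient_eq_0; [lia|]; intros i Hi; apply IH; lia. }
  destruct (ray_small 1 1 r0) as [d [Hd Hd']]; try lra.
  destruct (Hd' (d / 2)) as [HDz Hz]; [lra|].
  set (z := (d / 2 * 1, d / 2 * 1)) in *.
  (* With tolerance Im f(z) the constant partial sums p give |p - f(z)| < Im f(z), although Im f(z)
     <= |p - f(z)|. *)
  destruct (is_pseries_C_partial_sums _ _ _ (Im (f z)) (Hexp z HDz Hz) (Hf z HDz))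
    as [N HN].
  assert (Hs : forall n, sum_n (fun k => a k * z ^ k)%C n = RtoC p).
  { induction n as [|n IH].
    - rewrite sum_O, Ha0; simpl; ring.
    - rewrite sum_Sn, IH, (Hall (S n)) by lia; unfold plus; simpl; ring. }
  generalize (HN N (le_n N)); rewrite Hs; intros H.
  generalize (Im_le_Cmod (RtoC p - f z)%C) (Hf z HDz); simpl.
  unfold Im; rewrite Rplus_0_l, Rabs_Ropp; intros H1 H2.
  generalize (Rle_abs (snd (f z))); unfold Im in H; lra.
Qed.

(** The diagonal gives Re a_2 >= 0. On rays close to either axis x^2 - y^2 dominates x y and takes
    either sign, which leaves only Im a_2 = 0. *)
Lemma second_coefficient_pos : 0 < Re (a 2%nat) /\ Im (a 2%nat) = 0.
Proof.
  assert (Hlow : forall j, (1 <= j < 2)%nat -> a j = 0).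
  { intros j Hj; now replace j with 1%nat by lia. }
  assert (Hpos : forall x y, 0 < x -> 0 < y ->
      0 <= 2 * (x * y) * Re (a 2%nat) + (x ^ 2 - y ^ 2) * Im (a 2%nat)).
  { intros x y Hx Hy.
    generalize (leading_term_ge_0 2 x y ltac:(lia) Hlow Hx Hy).
    unfold Cpow, Cmult, Re, Im; simpl; lra. }
  assert (Hre : 0 <= Re (a 2%nat)) by (generalize (Hpos 1 1); lra).
  assert (Him : Im (a 2%nat) = 0).
  { set (u := Re _) in *; set (v := Im _) in *.
    destruct (Rtotal_order v 0) as [Hv|[Hv|Hv]]; [exfalso|trivial|exfalso].
    (* M is chosen with M (-v) > 2 u, so that on the ray through (M, 1) the term in v outweighs the
       one in u. *)
    - pose (M := 2 * u / (- v) + 2).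
      assert (HM : 0 <= 2 * u / (- v)).
      { apply Rmult_le_pos; [lra|apply Rlt_le, Rinv_0_lt_compat; lra]. }
      assert (HMu : M * (- v) = 2 * u + 2 * (- v)) by (unfold M; field; lra).
      generalize (Hpos M 1 ltac:(unfold M; lra) ltac:(lra)); unfold M in *; nra.
    - pose (M := 2 * u / v + 2).
      assert (HM : 0 <= 2 * u / v).
      { apply Rmult_le_pos; [lra|apply Rlt_le, Rinv_0_lt_compat; lra]. }
      assert (HMu : M * v = 2 * u + 2 * v) by (unfold M; field; lra).
      generalize (Hpos 1 M ltac:(lra) ltac:(unfold M; lra)); unfold M in *; nra. }
  split; [|trivial].
  destruct Hre as [|Hre]; [trivial|exfalso].
  apply second_coefficient_neq_0, injective_projections; simpl;
    unfold Re, Im in *; lra.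
Qed.

End Quadrant.

(** * The Loewner flow in real coordinates *)

Lemma Loewner_real_imaginary (T : R) (lam : R -> R) (gamma : R -> C)
    (h : C -> R -> C) (z : C) (t : R) :
  Loewner_equation T lam gamma h -> slit_domain gamma T z -> 0 < t < T ->
  is_derive (fun s => Re (h z s)) t
    (2 * (Re (h z t) - lam t) / ((Re (h z t) - lam t) ^ 2 + Im (h z t) ^ 2)) /\
  is_derive (fun s => Im (h z s)) t
    (- 2 * Im (h z t) / ((Re (h z t) - lam t) ^ 2 + Im (h z t) ^ 2)).
Proof.
  intros [_ Hode] [Hup Hns] Ht.
  assert (Hz : slit_domain gamma t z).
  { split; [trivial|]; intros [s [Hs E]]; apply Hns; exists s; split; [lra|trivial]. }
  specialize (Hode z t ltac:(lra) Hz).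
  set (l := (RtoC 2 / (h z t - RtoC (lam t)))%C) in *.
  (* At an interior time the restriction to [0, T] is vacuous near t, and the relative derivative
     becomes an ordinary one. *)
  assert (Hd : filterdiff (K := R_AbsRing) (U := R_NormedModule)
      (V := C_R_NormedModule) (h z) (locally t) (fun u => scal u l)).
  { destruct Hode as [Hlin Hdom]; split; [trivial|]; intros x Hx.
    assert (Ext : t = x).
    { apply (is_filter_lim_locally_unique (V := R_NormedModule)), Hx. }
    subst x; intros eps.
    assert (Hlim : is_filter_lim (within (fun u => 0 <= u <= T) (locally t)) t).
    { intros P HP; unfold within; revert HP; apply filter_imp; auto. }
    generalize (Hdom t Hlim eps); unfold within; intros Hw.
    assert (Hnear : locally t (fun u => 0 <= u <= T)).
    { exists (mkposreal (Rmin t (T - t)) ltac:(apply Rmin_glb_lt; lra)).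
      intros y Hy; revert Hy; unfold ball; simpl.
      unfold AbsRing_ball, abs, minus, plus, opp; simpl; intros Hy.
      generalize (Rmin_l t (T - t)) (Rmin_r t (T - t)).
      apply Rabs_def2 in Hy; lra. }
    generalize (filter_and _ _ Hw Hnear); apply filter_imp.
    intros y [Hy1 Hy2]; auto. }
  assert (Hre : is_linear (K := R_AbsRing) (U := C_R_NormedModule)
      (V := R_NormedModule) Re)
    by exact (is_linear_fst (K := R_AbsRing) (U := R_NormedModule)
      (V := R_NormedModule)).
  assert (Him : is_linear (K := R_AbsRing) (U := C_R_NormedModule)
      (V := R_NormedModule) Im)
    by exact (is_linear_snd (K := R_AbsRing) (U := R_NormedModule)
      (V := R_NormedModule)).
  split.
  - generalize (filterdiff_comp' (h z) Re t _ _ Hd (filterdiff_linear _ Hre)).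
    unfold is_derive; intros H; eapply filterdiff_ext_lin; [exact H|].
    intros y; unfold l, Re; simpl; unfold scal, mult; simpl; unfold mult; simpl.
    unfold Rdiv; rewrite Ropp_0, Rplus_0_r.
    replace (fst (h z t) + - lam t) with (fst (h z t) - lam t) by ring.
    unfold Re, Im; ring.
  - generalize (filterdiff_comp' (h z) Im t _ _ Hd (filterdiff_linear _ Him)).
    unfold is_derive; intros H; eapply filterdiff_ext_lin; [exact H|].
    intros y; unfold l, Im; simpl; unfold scal, mult; simpl; unfold mult; simpl.
    unfold Rdiv; rewrite Ropp_0, Rplus_0_r.
    replace (fst (h z t) + - lam t) with (fst (h z t) - lam t) by ring.
    unfold Re, Im; ring.
Qed.

Lemma derive_ge_0_increasing (f df : R -> R) (p q : R) :
  p <= q -> (forall s, p <= s <= q -> is_derive f s (df s) /\ 0 <= df s) ->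
  f p <= f q.
Proof.
  intros Hpq H.
  destruct (MVT_gen f p q df) as [c [Hc E]].
  - intros x Hx; rewrite Rmin_left, Rmax_right in Hx by trivial; apply H; lra.
  - intros x Hx; rewrite Rmin_left, Rmax_right in Hx by trivial.
    apply continuity_pt_filterlim, (ex_derive_continuous f).
    exists (df x); now apply H.
  - rewrite Rmin_left, Rmax_right in Hc by trivial.
    assert (0 <= df c * (q - p)) by (apply Rmult_le_pos; [now apply H|lra]); lra.
Qed.

(** A bootstrap: the weak bound up to s improves to the strict one at s. At the supremum of the
    times reached, continuity gives the weak bound, [Hstep] the strict one, and continuity then
    carries it further. *)
Lemma continuous_induction (f : R -> R) (p q m : R) :
  p <= q -> (forall s, p <= s <= q -> continuous f s) -> m < f p ->
  (forall s, p <= s <= q -> (forall s', p <= s' <= s -> m <= f s') -> m < f s) ->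
  forall s, p <= s <= q -> m < f s.
Proof.
  intros Hpq Hc Hp Hstep.
  pose (E := fun s => p <= s <= q /\ forall s', p <= s' <= s -> m < f s').
  destruct (completeness E) as [M [HM1 HM2]].
  { exists q; intros s [Hs _]; lra. }
  { exists p; split; [lra|]; intros s' Hs'; now replace s' with p by lra. }
  assert (HpM : p <= M).
  { apply HM1; split; [lra|]; intros s' Hs'; now replace s' with p by lra. }
  assert (HMq : M <= q) by (apply HM2; intros s [Hs _]; lra).
  assert (Hlt : forall s, p <= s < M -> m < f s).
  { intros s Hs; apply NNPP; intros Hn.
    assert (M <= s); [|lra].
    apply HM2; intros s' [Hs' H']; apply Rnot_lt_le; intros Hlt; apply Hn, H'; lra. }
  assert (HM : m < f M).
  { destruct (Rle_lt_or_eq_dec p M HpM) as [HpM'| <-]; [|trivial].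
    apply Hstep; [lra|]; intros s' Hs'.
    destruct (Rle_lt_or_eq_dec s' M (proj2 Hs')) as [| ->]; [apply Rlt_le, Hlt; lra|].
    apply Rnot_lt_le; intros Hlow.
    destruct (Hc M ltac:(lra) (fun y => y < m)) as [d Hd].
    { now apply open_lt. }
    pose (s := Rmax p (M - d / 2)).
    assert (Hs : p <= s /\ M - d / 2 <= s /\ s < M).
    { unfold s; repeat split; [apply Rmax_l|apply Rmax_r|].
      apply Rmax_lub_lt; [lra|generalize (cond_pos d); lra]. }
    generalize (Hlt s ltac:(lra)); apply Rle_not_lt, Rlt_le, Hd.
    unfold ball; simpl; unfold AbsRing_ball, abs, minus, plus, opp; simpl.
    generalize (cond_pos d); intros; apply Rabs_def1; lra. }
  intros s Hs; destruct (Rle_lt_dec s M) as [HsM|HsM].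
  { destruct (Rle_lt_or_eq_dec s M HsM) as [| ->]; [apply Hlt; lra|trivial]. }
  exfalso.
  destruct (Hc M ltac:(lra) (fun y => m < y)) as [d Hd].
  { now apply open_gt. }
  assert (HE : E (Rmin s (M + d / 2))).
  { generalize (Rmin_l s (M + d / 2)) (Rmin_r s (M + d / 2)) (cond_pos d).
    intros H1 H2 H3; split.
    - split; [apply Rmin_glb; lra|lra].
    - intros s' Hs'; destruct (Rlt_le_dec s' M); [apply Hlt; lra|].
      apply Hd; unfold ball; simpl.
      unfold AbsRing_ball, abs, minus, plus, opp; simpl; apply Rabs_def1; lra. }
  apply HM1 in HE; revert HE; apply Rlt_not_le.
  apply Rmin_glb_lt; [lra|generalize (cond_pos d); lra].
Qed.

Definition Loewner_flow (T : R) (lam u v : R -> R) : Prop :=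
  forall s, 0 < s < T ->
    is_derive u s (2 * (u s - lam s) / ((u s - lam s) ^ 2 + v s ^ 2)) /\
    is_derive v s (- 2 * v s / ((u s - lam s) ^ 2 + v s ^ 2)) /\
    0 < v s.

Section Flow.

Variables (T : R) (lam u v : R -> R).
Hypothesis Hflow : Loewner_flow T lam u v.

Lemma flow_denominator_pos (s : R) :
  0 < s < T -> 0 < (u s - lam s) ^ 2 + v s ^ 2.
Proof.
  intros Hs; destruct (Hflow s Hs) as [_ [_ Hv]].
  generalize (pow2_ge_0 (u s - lam s)) (pow_lt _ 2 Hv); lra.
Qed.

Lemma imaginary_part_decreasing (p q : R) : 0 < p -> p <= q < T -> v q <= v p.
Proof.
  intros Hp Hq.
  assert (- v p <= - v q); [|lra].
  apply (derive_ge_0_increasing (fun s => - v s)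
    (fun s => - (- 2 * v s / ((u s - lam s) ^ 2 + v s ^ 2)))); [lra|].
  intros s Hs; split.
  - apply (is_derive_opp v), Hflow; lra.
  - generalize (flow_denominator_pos s ltac:(lra)); intros H1.
    destruct (Hflow s ltac:(lra)) as [_ [_ H2]].
    replace (- (- 2 * v s / ((u s - lam s) ^ 2 + v s ^ 2)))
      with (2 * v s / ((u s - lam s) ^ 2 + v s ^ 2)) by (field; lra).
    apply Rlt_le, Rdiv_lt_0_compat; lra.
Qed.

(** As long as w = u - lam >= m, the speed 2 w / (w^2 + v^2) lies between 0 and 2/m whatever v is.
    So u increases and stays above L + m, which is the condition just used; [continuous_induction]
    closes the circle. *)
Lemma real_part_variation (p q L m : R) :
  0 < p -> p <= q < T -> 0 < m -> (forall s, p <= s <= q -> lam s <= L) ->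
  L + m < u p -> forall s, p <= s <= q -> u p <= u s <= u p + 2 / m * (s - p).
Proof.
  intros Hp Hq Hm HL Hup.
  assert (Hd : forall s, p <= s <= q -> L + m <= u s ->
      0 <= 2 * (u s - lam s) / ((u s - lam s) ^ 2 + v s ^ 2) <= 2 / m).
  { intros s Hs Hus; generalize (HL s Hs) (flow_denominator_pos s ltac:(lra)).
    set (w := u s - lam s) in *; intros HLs HD.
    assert (Hw : m <= w) by (unfold w; lra).
    split; [apply Rmult_le_pos; [lra|now apply Rlt_le, Rinv_0_lt_compat]|].
    apply (Rmult_le_reg_r (w ^ 2 + v s ^ 2)); [trivial|].
    unfold Rdiv at 1; rewrite Rmult_assoc, Rinv_l, Rmult_1_r by lra.
    apply (Rmult_le_reg_l m); [trivial|].
    replace (m * (2 / m * (w ^ 2 + v s ^ 2))) with (2 * (w ^ 2 + v s ^ 2))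
      by (field; lra).
    generalize (pow2_ge_0 (v s)); nra. }
  assert (Hinc : forall s, p <= s <= q ->
      (forall s', p <= s' <= s -> L + m <= u s') -> u p <= u s).
  { intros s Hs H.
    apply (derive_ge_0_increasing u
      (fun s => 2 * (u s - lam s) / ((u s - lam s) ^ 2 + v s ^ 2))); [lra|].
    intros s' Hs'; split; [apply Hflow; lra|].
    apply Hd; [lra|apply H; lra]. }
  assert (Hgt : forall s, p <= s <= q -> L + m < u s).
  { apply continuous_induction; [lra| |trivial|].
    - intros s Hs; apply (ex_derive_continuous u).
      eexists; apply Hflow; lra.
    - intros s Hs H; generalize (Hinc s Hs H); lra. }
  intros s Hs; split.
  - apply Hinc; [trivial|]; intros s' Hs'; apply Rlt_le, Hgt; lra.
  - assert (2 / m * p - u p <= 2 / m * s - u s); [|lra].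
    apply (derive_ge_0_increasing (fun s => 2 / m * s - u s)
      (fun s => 2 / m - 2 * (u s - lam s) / ((u s - lam s) ^ 2 + v s ^ 2)));
      [lra|].
    intros s' Hs'; split.
    + apply (is_derive_minus (fun s => 2 / m * s) u).
      * auto_derive; [trivial|ring].
      * apply Hflow; lra.
    + generalize (Hd s' ltac:(lra) (Rlt_le _ _ (Hgt s' ltac:(lra)))); lra.
Qed.

Lemma is_derive_ln_imaginary_part (al s : R) :
  0 < s < T ->
  is_derive (fun s => ln (v s) + al * ln s) s
    (al / s - 2 / ((u s - lam s) ^ 2 + v s ^ 2)).
Proof.
  intros Hs; generalize (flow_denominator_pos s Hs); intros H2.
  destruct (Hflow s Hs) as [_ [_ H1]].
  auto_derive.
  - split; [eexists; apply Hflow, Hs|]; repeat split; lra.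
  - change (fun x => v x) with v.
    rewrite (is_derive_unique v s _ (proj1 (proj2 (Hflow s Hs)))); field.
    repeat split; simpl in *; lra.
Qed.

(** The hypothesis bounds the decay rate of ln v by 2 / (k^2 s), which is exactly the growth rate of
    (2 / k^2) ln s. *)
Lemma imaginary_part_power_increasing (p q k : R) :
  0 < p -> p <= q < T -> 0 < k ->
  (forall s, p <= s <= q -> k ^ 2 * s <= (u s - lam s) ^ 2 + v s ^ 2) ->
  v p * Rpower p (2 / k ^ 2) <= v q * Rpower q (2 / k ^ 2).
Proof.
  intros Hp Hq Hk H.
  assert (Hexp : forall s, 0 < s < T ->
      v s * Rpower s (2 / k ^ 2) = exp (ln (v s) + 2 / k ^ 2 * ln s)).
  { intros s Hs; rewrite exp_plus, exp_ln by (now apply Hflow); reflexivity. }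
  rewrite !Hexp by lra.
  assert (Hln : ln (v p) + 2 / k ^ 2 * ln p <= ln (v q) + 2 / k ^ 2 * ln q).
  { apply (derive_ge_0_increasing (fun s => ln (v s) + 2 / k ^ 2 * ln s)
      (fun s => 2 / k ^ 2 / s - 2 / ((u s - lam s) ^ 2 + v s ^ 2))); [lra|].
    intros s Hs; split; [apply is_derive_ln_imaginary_part; lra|].
    assert (0 < k ^ 2) by now apply pow_lt.
    replace (2 / k ^ 2 / s) with (2 / (k ^ 2 * s)) by (field; lra).
    assert (/ ((u s - lam s) ^ 2 + v s ^ 2) <= / (k ^ 2 * s)).
    { apply Rinv_le_contravar; [apply Rmult_lt_0_compat; lra|now apply H]. }
    unfold Rdiv; lra. }
  destruct Hln as [Hln|Hln]; [now apply Rlt_le, exp_increasing|].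
  rewrite Hln; lra.
Qed.

Lemma imaginary_part_power_decreasing (p q k : R) :
  0 < p -> p <= q < T -> 0 < k ->
  (forall s, p <= s <= q -> (u s - lam s) ^ 2 + v s ^ 2 <= k ^ 2 * s) ->
  v q * Rpower q (2 / k ^ 2) <= v p * Rpower p (2 / k ^ 2).
Proof.
  intros Hp Hq Hk H.
  assert (Hexp : forall s, 0 < s < T ->
      v s * Rpower s (2 / k ^ 2) = exp (ln (v s) + 2 / k ^ 2 * ln s)).
  { intros s Hs; rewrite exp_plus, exp_ln by (now apply Hflow); reflexivity. }
  rewrite !Hexp by lra.
  assert (Hln : - (ln (v p) + 2 / k ^ 2 * ln p)
      <= - (ln (v q) + 2 / k ^ 2 * ln q)).
  { apply (derive_ge_0_increasing (fun s => - (ln (v s) + 2 / k ^ 2 * ln s))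
      (fun s => - (2 / k ^ 2 / s - 2 / ((u s - lam s) ^ 2 + v s ^ 2)))); [lra|].
    intros s Hs; split.
    { apply (is_derive_opp (fun s => ln (v s) + 2 / k ^ 2 * ln s)).
      apply is_derive_ln_imaginary_part; lra. }
    assert (0 < k ^ 2) by now apply pow_lt.
    replace (2 / k ^ 2 / s) with (2 / (k ^ 2 * s)) by (field; lra).
    assert (/ (k ^ 2 * s) <= / ((u s - lam s) ^ 2 + v s ^ 2)).
    { apply Rinv_le_contravar; [apply flow_denominator_pos; lra|now apply H]. }
    unfold Rdiv; lra. }
  apply Ropp_le_cancel in Hln.
  destruct Hln as [Hln|Hln]; [now apply Rlt_le, exp_increasing|].
  rewrite Hln; lra.
Qed.

End Flow.

(** It gives sqrt the same modulus of continuity as a driving term in Lip(1/2), so one grid step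
    controls both. *)
Lemma sqrt_increment (p s : R) : 0 <= p <= s -> 0 <= sqrt s - sqrt p <= sqrt (s - p).
Proof.
  intros H; generalize (sqrt_le_1 p s ltac:(lra) ltac:(lra) ltac:(lra)); intros H1.
  split; [lra|].
  assert (sqrt s <= sqrt p + sqrt (s - p)); [|lra].
  generalize (sqrt_pos p) (sqrt_pos (s - p)); intros H2 H3.
  rewrite <- (sqrt_pow2 (sqrt p + sqrt (s - p))) by lra.
  apply sqrt_le_1; [lra|apply pow2_ge_0|].
  replace ((sqrt p + sqrt (s - p)) ^ 2)
    with (sqrt p ^ 2 + sqrt (s - p) ^ 2 + 2 * (sqrt p * sqrt (s - p))) by ring.
  rewrite !pow2_sqrt by lra.
  generalize (Rmult_le_pos _ _ H2 H3); lra.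
Qed.

(* Pointwise convergence of [u r] upgrades to a uniform estimate: as long as
   [u r - lam] stays away from 0 the speed of [u r] is bounded independently of
   [r], so a finite grid of times is enough. *)
Lemma flow_uniform_estimate (T k e t1 t2 d0 : R) (lam hp : R -> R)
    (u v : R -> R -> R) :
  Lip_half T lam -> 0 < t1 -> t1 <= t2 -> t2 < T -> 0 < k -> 0 < e < k / 2 ->
  0 < d0 -> (forall r, 0 < r < d0 -> Loewner_flow T lam (u r) (v r)) ->
  (forall s, t1 <= s <= t2 -> Rabs (hp s - lam s - k * sqrt s) <= e * sqrt s) ->
  (forall s, 0 < s <= T -> forall m, 0 < m -> exists d, 0 < d /\
     forall r, 0 < r < d -> Rabs (u r s - hp s) <= m /\ Rabs (v r s) <= m) ->
  exists d, 0 < d /\ forall r, 0 < r < d -> forall s, t1 <= s <= t2 ->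
    Rabs (u r s - lam s - k * sqrt s) <= 2 * e * sqrt s /\
    0 <= v r s <= e * sqrt s.
Proof.
  intros [K HK] Ht1 Ht12 Ht2 Hk He Hd0 Hflow Hhp Hlim.
  assert (Hst1 : 0 < sqrt t1) by now apply sqrt_lt_R0.
  assert (Hsq : forall s, t1 <= s -> sqrt t1 <= sqrt s).
  { intros s Hs; apply sqrt_le_1; lra. }
  (* Since e < k / 2, [del] is a lower bound for hp - lam on [t1, t2]. *)
  pose (del := k / 2 * sqrt t1).
  assert (Hdel : 0 < del) by (apply Rmult_lt_0_compat; lra).
  (* [del / 4] keeps u away from lam within a grid cell. The factor 3 + k counts the errors there: u
     against hp at the left end, the motion of u, the motion of lam, and k times that of sqrt. *)
  pose (e1 := Rmin (del / 4) (e * sqrt t1 / (3 + k))).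
  assert (He1 : 0 < e1).
  { apply Rmin_glb_lt; [lra|].
    apply Rdiv_lt_0_compat; [apply Rmult_lt_0_compat|]; lra. }
  assert (He1d : e1 <= del / 4) by apply Rmin_l.
  assert (He1k : (3 + k) * e1 <= e * sqrt t1).
  { replace (e * sqrt t1) with ((3 + k) * (e * sqrt t1 / (3 + k))) by (field; lra).
    apply Rmult_le_compat_l; [lra|apply Rmin_r]. }
  assert (HK0 := Rabs_pos K).
  pose (rho := e1 / (Rabs K + 1)).
  assert (Hrho : 0 < rho) by (apply Rdiv_lt_0_compat; lra).
  assert (HKrho : (Rabs K + 1) * rho = e1) by (unfold rho; field; lra).
  (* The grid step: rho^2 keeps lam and sqrt within e1, and e1 del / 8 times the maximal speed 2 /
     (del / 4) of u is e1. *)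
  pose (eta := Rmin (rho ^ 2) (e1 * del / 8)).
  assert (Heta : 0 < eta).
  { apply Rmin_glb_lt; [now apply pow_lt|].
    apply Rdiv_lt_0_compat; [now apply Rmult_lt_0_compat|lra]. }
  assert (Hsqeta : sqrt eta <= rho).
  { rewrite <- (sqrt_pow2 rho) by lra.
    apply sqrt_le_1; [lra|apply pow2_ge_0|apply Rmin_l]. }
  assert (Hlam : forall p s, t1 <= p -> p <= s <= p + eta -> s <= t2 ->
      Rabs (lam s - lam p) <= e1 /\ Rabs (sqrt p - sqrt s) <= e1).
  { intros p s Hp Hs Hst.
    assert (Hsp : sqrt (s - p) <= rho).
    { eapply Rle_trans; [|exact Hsqeta]; apply sqrt_le_1; lra. }
    assert (Hsp0 := sqrt_pos (s - p)).
    split.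
    - eapply Rle_trans; [apply HK; lra|].
      rewrite (Rabs_pos_eq (s - p)) by lra.
      apply Rle_trans with (Rabs K * rho); [|nra].
      apply Rle_trans with (Rabs K * sqrt (s - p)).
      + apply Rmult_le_compat_r; [trivial|apply Rle_abs].
      + apply Rmult_le_compat_l; trivial.
    - destruct (sqrt_increment p s ltac:(lra)) as [H1 H2].
      rewrite Rabs_minus_sym, Rabs_pos_eq by trivial; nra. }
  assert (Hgrid : forall n, exists d, 0 < d /\ forall r, 0 < r < d ->
      forall s, t1 <= s <= t2 -> s <= t1 + INR n * eta ->
      Rabs (u r s - lam s - k * sqrt s) <= 2 * e * sqrt s).
  2:{ destruct (INR_unbounded ((t2 - t1) / eta)) as [N HN].
    destruct (Hgrid N) as [d1 [Hd1 Hd1']].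
    assert (Hes : 0 < e * sqrt t1) by (apply Rmult_lt_0_compat; lra).
    destruct (Hlim t1 ltac:(lra) (e * sqrt t1) Hes) as [d2 [Hd2 Hd2']].
    exists (Rmin d0 (Rmin d1 d2)); split; [now repeat apply Rmin_glb_lt|].
    intros r Hr s Hs.
    generalize (Rmin_l d0 (Rmin d1 d2)) (Rmin_r d0 (Rmin d1 d2)) (Rmin_l d1 d2)
      (Rmin_r d1 d2); intros Hm1 Hm2 Hm3 Hm4.
    split; [apply Hd1'; try lra|].
    - apply Rle_trans with t2; [lra|].
      assert ((t2 - t1) / eta * eta <= INR N * eta)
        by (apply Rmult_le_compat_r; lra).
      replace ((t2 - t1) / eta * eta) with (t2 - t1) in H by (field; lra); lra.
    - assert (Hfl := Hflow r ltac:(lra)); split.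
      + apply Rlt_le, Hfl; lra.
      (* v decreases in time, so its smallness at t1 alone is enough. *)
      + apply Rle_trans with (v r t1).
        * apply (imaginary_part_decreasing T lam (u r) (v r)); trivial; lra.
        * destruct (Hd2' r ltac:(lra)) as [_ Hv].
          apply Rle_trans with (e * sqrt t1).
          { eapply Rle_trans; [apply Rle_abs|exact Hv]. }
          apply Rmult_le_compat_l; [lra|apply Hsq; lra]. }
  assert (Hstep : forall p, t1 <= p <= t2 -> exists d, 0 < d /\
      forall r, 0 < r < d -> forall s, p <= s <= t2 -> s <= p + eta ->
      Rabs (u r s - lam s - k * sqrt s) <= 2 * e * sqrt s).
  { intros p Hp.
    destruct (Hlim p ltac:(lra) e1 He1) as [d [Hd Hd']].
    exists (Rmin d0 d); split; [now apply Rmin_glb_lt|]; intros r Hr s Hs Hse.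
    generalize (Rmin_l d0 d) (Rmin_r d0 d); intros Hm1 Hm2.
    assert (Hfl := Hflow r ltac:(lra)).
    destruct (Hd' r ltac:(lra)) as [Hu _].
    apply Rabs_le_between in Hu.
    generalize (Hhp p ltac:(lra)); intros Hhpp; apply Rabs_le_between in Hhpp.
    assert (Hsp := Hsq p ltac:(lra)).
    assert (Hbase : del <= hp p - lam p).
    { apply Rle_trans with ((k - e) * sqrt p); [|lra].
      unfold del; apply Rmult_le_compat; lra. }
    destruct (real_part_variation T lam (u r) (v r)) with
      (p := p) (q := s) (L := lam p + del / 4) (m := del / 4) (s := s)
      as [Hu1 Hu2]; trivial; try lra.
    { intros x Hx; destruct (Hlam p x) as [Hl _]; try lra.
      apply Rabs_le_between in Hl; lra. }
    assert (Huu : 2 / (del / 4) * (s - p) <= e1).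
    { apply Rle_trans with (2 / (del / 4) * (e1 * del / 8)).
      - apply Rmult_le_compat_l; [apply Rlt_le, Rdiv_lt_0_compat; lra|].
        assert (eta <= e1 * del / 8) by apply Rmin_r; lra.
      - apply Req_le; field; lra. }
    destruct (Hlam p s) as [Hl1 Hl2]; try lra.
    assert (Hps : e * sqrt p <= e * sqrt s).
    { apply Rmult_le_compat_l; [lra|apply sqrt_le_1; lra]. }
    assert (Hts : e * sqrt t1 <= e * sqrt s).
    { apply Rmult_le_compat_l; [lra|apply Hsq; lra]. }
    apply Rabs_le_between in Hl1; apply Rabs_le_between in Hl2.
    assert (Hks : - (k * e1) <= k * (sqrt p - sqrt s) <= k * e1) by (split; nra).
    apply Rabs_le_between; split; lra. }
  induction n as [|n [d1 [Hd1 IH]]].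
  - destruct (Hstep t1 ltac:(lra)) as [d [Hd H]].
    exists d; split; [trivial|]; intros r Hr s Hs Hs'; apply H; try lra.
    simpl in Hs'; lra.
  - destruct (Rle_dec (t1 + INR n * eta) t2) as [Hn|Hn].
    + assert (0 <= INR n * eta) by (apply Rmult_le_pos; [apply pos_INR|lra]).
      destruct (Hstep (t1 + INR n * eta) ltac:(lra)) as [d2 [Hd2 H2]].
      exists (Rmin d1 d2); split; [now apply Rmin_glb_lt|]; intros r Hr s Hs Hs'.
      generalize (Rmin_l d1 d2) (Rmin_r d1 d2); intros Hm1 Hm2.
      rewrite S_INR in Hs'.
      destruct (Rle_dec s (t1 + INR n * eta)).
      * apply IH; lra.
      * apply H2; lra.
    + exists d1; split; [trivial|]; intros r Hr s Hs _; apply IH; lra.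
Qed.

(** * Growth of the second coefficient *)

Lemma Rpower_lt_near_0 (al e : R) :
  0 < al -> 0 < e ->
  exists d, 0 < d /\ forall t, 0 < t < d -> Rpower t al < e.
Proof.
  intros Hal He; exists (Rpower e (/ al)); split; [apply exp_pos|].
  intros t Ht.
  replace e with (Rpower (Rpower e (/ al)) al).
  - now apply Rlt_Rpower_l.
  - rewrite Rpower_mult, Rinv_l, Rpower_1; lra.
Qed.

(** The limit r -> 0 of f / r^2 <= g / r^2 in quantitative form: if x > y, then at the chosen r the
    cubic errors amount to at most half of (x - y) r^2. *)
Lemma quadratic_leading_coefficient_le (f g : R -> R) (x y B1 B2 d : R) :
  0 < d -> 0 < B1 -> 0 < B2 ->
  (forall r, 0 < r < d -> Rabs (f r - x * r ^ 2) <= B1 * r ^ 3 /\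
     Rabs (g r - y * r ^ 2) <= B2 * r ^ 3 /\ f r <= g r) ->
  x <= y.
Proof.
  intros Hd HB1 HB2 H; apply Rnot_lt_le; intros Hxy.
  pose (r := Rmin (d / 2) ((x - y) / (2 * (B1 + B2)))).
  assert (Hr : 0 < r) by (apply Rmin_glb_lt; [|apply Rdiv_lt_0_compat]; lra).
  assert (Hrd : r <= d / 2) by apply Rmin_l.
  assert (HrB : (B1 + B2) * r <= (x - y) / 2).
  { replace ((x - y) / 2) with ((B1 + B2) * ((x - y) / (2 * (B1 + B2))))
      by (field; lra).
    apply Rmult_le_compat_l; [lra|apply Rmin_r]. }
  destruct (H r ltac:(lra)) as [H1 [H2 H3]].
  apply Rabs_le_between in H1; apply Rabs_le_between in H2.
  assert (Hr2 : 0 < r ^ 2) by now apply pow_lt.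
  assert (Hr3 : (B1 + B2) * r ^ 3 <= (x - y) / 2 * r ^ 2).
  { replace ((B1 + B2) * r ^ 3) with ((B1 + B2) * r * r ^ 2) by ring.
    apply Rmult_le_compat_r; lra. }
  assert (0 < (x - y) * r ^ 2) by (apply Rmult_lt_0_compat; lra).
  lra.
Qed.

(** The real part is known up to 2 e sqrt s, whence k - 2 e; the upper value k + 3 e leaves room for
    the contribution of v as well. *)
Lemma exponents_near (k eps : R) :
  0 < k -> 0 < eps -> exists e, 0 < e < k / 2 /\
    2 / (k - 2 * e) ^ 2 < 2 / k ^ 2 + eps /\
    2 / k ^ 2 - eps < 2 / (k + 3 * e) ^ 2.
Proof.
  intros Hk Heps.
  assert (Hc : forall m, exists d : posreal, forall e, Rabs e < d ->
      Rabs (2 / (k + m * e) ^ 2 - 2 / k ^ 2) < eps).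
  { intros m.
    assert (Hcont : continuous (fun e => 2 / (k + m * e) ^ 2) 0).
    { apply (ex_derive_continuous (fun e => 2 / (k + m * e) ^ 2)).
      auto_derive; rewrite Rmult_0_r, Rplus_0_r.
      apply Rmult_integral_contrapositive; split; [lra|].
      apply Rmult_integral_contrapositive; split; lra. }
    destruct (Hcont (ball (2 / (k + m * 0) ^ 2) eps)) as [d Hd].
    { now exists (mkposreal eps Heps). }
    exists d; intros e He.
    generalize (Hd e); unfold ball; simpl.
    unfold AbsRing_ball, abs, minus, plus, opp; simpl.
    rewrite Rmult_0_r, Rplus_0_r, Ropp_0, Rplus_0_r; auto. }
  destruct (Hc (- 2)) as [d1 H1]; destruct (Hc 3) as [d2 H2].
  pose (e := Rmin (k / 4) (Rmin (d1 / 2) (d2 / 2))).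
  assert (He : 0 < e <= k / 4 /\ e <= d1 / 2 /\ e <= d2 / 2).
  { generalize (cond_pos d1) (cond_pos d2); intros; unfold e.
    generalize (Rmin_l (d1 / 2) (d2 / 2)) (Rmin_r (d1 / 2) (d2 / 2))
      (Rmin_l (k / 4) (Rmin (d1 / 2) (d2 / 2)))
      (Rmin_r (k / 4) (Rmin (d1 / 2) (d2 / 2))).
    intros; repeat split; try lra; repeat apply Rmin_glb_lt; lra. }
  generalize (cond_pos d1) (cond_pos d2); intros Hd1 Hd2.
  specialize (H1 e); specialize (H2 e).
  rewrite Rabs_pos_eq in H1, H2 by lra.
  specialize (H1 ltac:(lra)); specialize (H2 ltac:(lra)).
  apply Rabs_def2 in H1; apply Rabs_def2 in H2.
  replace (k + - 2 * e) with (k - 2 * e) in H1 by ring.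
  exists e; repeat split; lra.
Qed.

Lemma at_right_0_elim (f : R -> R) (l : R) :
  filterlim f (at_right 0) (locally l) -> forall e, 0 < e ->
  exists d, 0 < d /\ forall t, 0 < t < d -> Rabs (f t - l) < e.
Proof.
  intros H e He.
  destruct (H (ball l e)) as [d Hd]; [now exists (mkposreal e He)|].
  exists d; split; [apply cond_pos|]; intros t Ht.
  apply (Hd t); [|lra].
  unfold ball; simpl; unfold AbsRing_ball, abs, minus, plus, opp; simpl.
  rewrite Rabs_pos_eq; lra.
Qed.

Lemma at_right_0_intro (P : R -> Prop) (d : R) :
  0 < d -> (forall t, 0 < t < d -> P t) -> at_right 0 P.
Proof.
  intros Hd H; exists (mkposreal d Hd); intros t Ht Ht0; apply H; split; [trivial|].
  revert Ht; unfold ball; simpl; unfold AbsRing_ball, abs, minus, plus, opp; simpl.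
  intros Ht; apply Rabs_def2 in Ht; lra.
Qed.

Lemma right_image_near (gamma : R -> C) (h : C -> R -> C) (t p m : R) :
  right_image gamma h t p -> 0 < m -> exists d, 0 < d /\
    forall z, right_side gamma t z -> Cmod z < d ->
      Rabs (Re (h z t) - p) <= m /\ Rabs (Im (h z t)) <= m.
Proof.
  intros H Hm.
  destruct (H (ball (RtoC p : C) m)) as [d Hd]; [now exists (mkposreal m Hm)|].
  exists d; split; [apply cond_pos|]; intros z Hz Hzd.
  assert (Hb : ball (RtoC 0 : C) d z).
  { generalize (Rmax_Cmod z); intros Hmax.
    generalize (Rmax_l (Rabs (fst z)) (Rabs (snd z)))
      (Rmax_r (Rabs (fst z)) (Rabs (snd z))); intros H1 H2.
    split; unfold ball; simpl; unfold AbsRing_ball, abs, minus, plus, opp; simpl;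
      rewrite Ropp_0, Rplus_0_r; lra. }
  generalize (Hd z Hb Hz); intros [H1 H2]; revert H1 H2.
  unfold ball; simpl; unfold AbsRing_ball, abs, minus, plus, opp; simpl.
  rewrite Ropp_0, Rplus_0_r; unfold Re, Im; split; apply Rlt_le; trivial.
Qed.

Section Coefficient.

(** Here [k] stands for b - c, and [Hlim] combines the two limits at 0 into one estimate. *)
Variables (T : R) (lam : R -> R) (gamma : R -> C) (h : C -> R -> C)
  (hplus : R -> R) (a : R -> nat -> C) (k : R).
Hypothesis HT : 0 < T.
Hypothesis Hlip : Lip_half T lam.
Hypothesis Hslit : generates_slit_maps T lam gamma h.
Hypothesis Hanalytic : symmetric_analytic_curve T gamma.
Hypothesis Hplus : forall t, 0 < t <= T -> right_image gamma h t (hplus t).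
Hypothesis Ha : forall t, 0 < t <= T -> right_expansion gamma h t (hplus t) (a t).
Hypothesis Hk : 0 < k.
Hypothesis Hlim : forall e, 0 < e -> exists d, 0 < d /\
  forall t, 0 < t < d -> Rabs (hplus t - lam t - k * sqrt t) <= e * sqrt t.

Lemma right_side_ray (t x y : R) :
  0 < t <= T -> 0 < x -> 0 < y -> exists d, 0 < d /\
    forall r, 0 < r < d -> right_side gamma t (r * x, r * y).
Proof.
  intros Ht Hx Hy; now apply (ray_in_right_side T); [| apply Hslit| | | |].
Qed.

Lemma right_side_Im_pos (t : R) (z : C) :
  0 < t <= T -> right_side gamma t z -> 0 < Im (h z t).
Proof.
  intros Ht [Hz _]; destruct Hslit as [_ [_ Hconf]].
  destruct (Hconf t ltac:(lra)) as [[_ [Hin _]] _]; exact (Hin z Hz).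
Qed.

Lemma a2_pos (t : R) : 0 < t <= T -> 0 < Re (a t 2%nat) /\ Im (a t 2%nat) = 0.
Proof.
  intros Ht; destruct (Ha t Ht) as [Ha0 [Ha1 [r [Hr Hexp]]]].
  apply (second_coefficient_pos (right_side gamma t) (fun z => h z t) (a t)
    (hplus t) r); trivial.
  - intros x y; now apply right_side_ray.
  - intros z; now apply right_side_Im_pos.
Qed.

(** Since (1 + i)^2 = 2 i, the imaginary part on the diagonal sees twice the real part of a_2. *)
Lemma Im_on_diagonal (t : R) :
  0 < t <= T -> exists B d, 0 < B /\ 0 < d /\ forall r, 0 < r < d ->
    Rabs (Im (h (r * 1, r * 1) t) - 2 * Re (a t 2%nat) * r ^ 2) <= B * r ^ 3.
Proof.
  intros Ht; destruct (Ha t Ht) as [Ha0 [Ha1 [r0 [Hr0 Hexp]]]].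
  destruct (leading_term_on_ray (right_side gamma t) (fun z => h z t) (a t)
    (hplus t) r0) with (k := 2%nat) (x := 1) (y := 1)
    as [B [d [HB [Hd H]]]]; trivial; try lra; try lia.
  - intros x y; now apply right_side_ray.
  - intros j Hj; now replace j with 1%nat by lia.
  - exists B, d; repeat split; trivial; intros r Hr.
    destruct (H r Hr) as [_ Hle]; eapply Rle_trans; [apply Req_le|exact Hle].
    f_equal; unfold Cpow, Cmult, Re, Im, RtoC; simpl; ring.
Qed.

(** A point to the right of the slit at time T is off the whole slit, so its trajectory exists on
    all of [0, T] and one d serves every time. *)
Lemma diagonal_flow :
  exists d, 0 < d /\ forall r, 0 < r < d ->
    Loewner_flow T lam (fun s => Re (h (r * 1, r * 1) s))
      (fun s => Im (h (r * 1, r * 1) s)).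
Proof.
  destruct (right_side_ray T 1 1) as [d [Hd H]]; try lra.
  exists d; split; [trivial|]; intros r Hr s Hs.
  destruct (H r Hr) as [Hz _].
  destruct Hslit as [_ [Hode Hconf]].
  destruct (Loewner_real_imaginary T lam gamma h _ s Hode Hz Hs) as [H1 H2].
  split; [exact H1|split; [exact H2|]].
  destruct (Hconf s ltac:(lra)) as [[_ [Hin _]] _]; apply Hin.
  destruct Hz as [Hup Hns]; split; [trivial|].
  intros [s' [Hs' E]]; apply Hns; exists s'; split; [lra|trivial].
Qed.

Lemma diagonal_limit (s m : R) :
  0 < s <= T -> 0 < m -> exists d, 0 < d /\ forall r, 0 < r < d ->
    Rabs (Re (h (r * 1, r * 1) s) - hplus s) <= m /\
    Rabs (Im (h (r * 1, r * 1) s)) <= m.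
Proof.
  intros Hs Hm.
  destruct (right_image_near gamma h s _ m (Hplus s Hs) Hm) as [d1 [Hd1 H1]].
  destruct (ray_small (right_side gamma s)) with (x := 1) (y := 1) (m := d1)
    as [d [Hd H]]; try lra.
  { intros x y; now apply right_side_ray. }
  exists d; split; [trivial|]; intros r Hr; now apply H1; apply H.
Qed.

(** [t0] is chosen before t. The admissible r do depend on t, which is harmless because r -> 0 is
    taken with t and t0 fixed. *)
Lemma a2_power_monotone (e : R) :
  0 < e < k / 2 -> exists t0, 0 < t0 < T /\ forall t, 0 < t < t0 ->
    Re (a t 2%nat) * Rpower t (2 / (k - 2 * e) ^ 2)
      <= Re (a t0 2%nat) * Rpower t0 (2 / (k - 2 * e) ^ 2) /\
    Re (a t0 2%nat) * Rpower t0 (2 / (k + 3 * e) ^ 2)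
      <= Re (a t 2%nat) * Rpower t (2 / (k + 3 * e) ^ 2).
Proof.
  intros He; destruct (Hlim e ltac:(lra)) as [d0 [Hd0 Hhp]].
  pose (t0 := Rmin (d0 / 2) (T / 2)).
  assert (Ht0 : 0 < t0) by (apply Rmin_glb_lt; lra).
  assert (Ht0d : t0 <= d0 / 2) by apply Rmin_l.
  assert (Ht0T : t0 <= T / 2) by apply Rmin_r.
  exists t0; split; [lra|]; intros t Ht.
  destruct diagonal_flow as [d1 [Hd1 Hflow]].
  destruct (flow_uniform_estimate T k e t t0 d1 lam hplus
    (fun r s => Re (h (r * 1, r * 1) s)) (fun r s => Im (h (r * 1, r * 1) s)))
    as [d2 [Hd2 Hest]]; trivial; try lra.
  { intros s Hs; apply Hhp; lra. }
  { intros s Hs m Hm; now apply diagonal_limit. }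
  destruct (Im_on_diagonal t) as [B1 [d3 [HB1 [Hd3 H1]]]]; [lra|].
  destruct (Im_on_diagonal t0) as [B2 [d4 [HB2 [Hd4 H2]]]]; [lra|].
  pose (d := Rmin (Rmin d1 d2) (Rmin d3 d4)).
  assert (Hd : 0 < d) by (unfold d; repeat apply Rmin_glb_lt; trivial).
  assert (Hdle : d <= d1 /\ d <= d2 /\ d <= d3 /\ d <= d4).
  { unfold d; generalize (Rmin_l (Rmin d1 d2) (Rmin d3 d4))
      (Rmin_r (Rmin d1 d2) (Rmin d3 d4)) (Rmin_l d1 d2) (Rmin_r d1 d2)
      (Rmin_l d3 d4) (Rmin_r d3 d4); lra. }
  assert (Hden : forall r, 0 < r < d -> forall s, t <= s <= t0 ->
      (k - 2 * e) ^ 2 * s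
        <= (Re (h (r * 1, r * 1) s) - lam s) ^ 2 + Im (h (r * 1, r * 1) s) ^ 2
        <= (k + 3 * e) ^ 2 * s).
  { intros r Hr s Hs.
    destruct (Hest r ltac:(lra) s Hs) as [Hu Hv].
    set (w := Re _ - lam s) in *; set (v := Im _) in *.
    apply Rabs_le_between in Hu.
    assert (Hq : 0 < sqrt s) by (apply sqrt_lt_R0; lra).
    replace s with (sqrt s ^ 2) by (apply pow2_sqrt; lra).
    rewrite <- !Rpow_mult_distr.
    assert (Hlow : 0 < (k - 2 * e) * sqrt s) by (apply Rmult_lt_0_compat; lra).
    assert (H3 : ((k - 2 * e) * sqrt s) ^ 2 <= w ^ 2) by (apply pow_incr; lra).
    assert (H4 : w ^ 2 <= ((k + 2 * e) * sqrt s) ^ 2) by (apply pow_incr; lra).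
    assert (H5 : v ^ 2 <= (e * sqrt s) ^ 2) by (apply pow_incr; lra).
    split; [generalize (pow2_ge_0 v); lra|].
    (* The margin 3 e comes from (k + 2 e)^2 + e^2 <= (k + 3 e)^2. *)
    apply Rle_trans with (((k + 2 * e) * sqrt s) ^ 2 + (e * sqrt s) ^ 2); [lra|].
    rewrite !Rpow_mult_distr, <- Rmult_plus_distr_r.
    apply Rmult_le_compat_r; [apply pow2_ge_0|].
    assert (0 < k * e) by (apply Rmult_lt_0_compat; lra); nra. }
  assert (Hscale : forall s B c r, 0 < c ->
      Rabs (Im (h (r * 1, r * 1) s) - 2 * Re (a s 2%nat) * r ^ 2) <= B * r ^ 3 ->
      Rabs (Im (h (r * 1, r * 1) s) * c - 2 * (Re (a s 2%nat) * c) * r ^ 2)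
        <= B * c * r ^ 3).
  { intros s B c r Hc H.
    replace (Im (h (r * 1, r * 1) s) * c - 2 * (Re (a s 2%nat) * c) * r ^ 2)
      with ((Im (h (r * 1, r * 1) s) - 2 * Re (a s 2%nat) * r ^ 2) * c) by ring.
    rewrite Rabs_mult, (Rabs_pos_eq c) by lra.
    replace (B * c * r ^ 3) with (B * r ^ 3 * c) by ring.
    apply Rmult_le_compat_r; lra. }
  assert (Hpos : forall x y, 0 < Rpower x y) by (intros; apply exp_pos).
  split.
  - set (al := 2 / _).
    assert (2 * (Re (a t 2%nat) * Rpower t al)
      <= 2 * (Re (a t0 2%nat) * Rpower t0 al)); [|lra].
    apply (quadratic_leading_coefficient_le
      (fun r => Im (h (r * 1, r * 1) t) * Rpower t al)
      (fun r => Im (h (r * 1, r * 1) t0) * Rpower t0 al) _ _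
      (B1 * Rpower t al) (B2 * Rpower t0 al) d); trivial;
      try now apply Rmult_lt_0_compat.
    intros r Hr; repeat split.
    + apply Hscale; [trivial|apply H1; lra].
    + apply Hscale; [trivial|apply H2; lra].
    + assert (Hfl := Hflow r ltac:(lra)).
      apply (imaginary_part_power_increasing T lam
        (fun s => Re (h (r * 1, r * 1) s)) (fun s => Im (h (r * 1, r * 1) s)));
        trivial; try lra.
      intros s Hs; now apply Hden.
  - set (al := 2 / _).
    assert (2 * (Re (a t0 2%nat) * Rpower t0 al)
      <= 2 * (Re (a t 2%nat) * Rpower t al)); [|lra].
    apply (quadratic_leading_coefficient_le
      (fun r => Im (h (r * 1, r * 1) t0) * Rpower t0 al)
      (fun r => Im (h (r * 1, r * 1) t) * Rpower t al) _ _
      (B2 * Rpower t0 al) (B1 * Rpower t al) d); trivial;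
      try now apply Rmult_lt_0_compat.
    intros r Hr; repeat split.
    + apply Hscale; [trivial|apply H2; lra].
    + apply Hscale; [trivial|apply H1; lra].
    + assert (Hfl := Hflow r ltac:(lra)).
      apply (imaginary_part_power_decreasing T lam
        (fun s => Re (h (r * 1, r * 1) s)) (fun s => Im (h (r * 1, r * 1) s)));
        trivial; try lra.
      intros s Hs; now apply Hden.
Qed.

(** With al < 2 / k^2 + eps, monotonicity bounds a_2 t^al by its value M at t0, and the remaining
    positive power of t tends to 0. *)
Lemma a2_power_to_0 (eps : R) :
  0 < eps ->
  filterlim (fun t => (a t 2%nat * RtoC (Rpower t (2 / k ^ 2 + eps)))%C)
    (at_right 0) (locally (RtoC 0)).
Proof.
  intros Heps; destruct (exponents_near k eps Hk Heps) as [e [He [Hal _]]].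
  destruct (a2_power_monotone e He) as [t0 [Ht0 Hmono]].
  set (al := 2 / (k - 2 * e) ^ 2) in *.
  set (M := Re (a t0 2%nat) * Rpower t0 al) in *.
  assert (HM : 0 < M).
  { apply Rmult_lt_0_compat; [apply a2_pos; lra|apply exp_pos]. }
  intros P [m Hm].
  destruct (Rpower_lt_near_0 (2 / k ^ 2 + eps - al) (m / M)) as [d [Hd Hsmall]].
  { lra. }
  { apply Rdiv_lt_0_compat; [apply cond_pos|trivial]. }
  apply at_right_0_intro with (Rmin d t0); [apply Rmin_glb_lt; lra|].
  intros t Ht; generalize (Rmin_l d t0) (Rmin_r d t0); intros Hl Hr.
  destruct (a2_pos t ltac:(lra)) as [Hre Him].
  destruct (Hmono t ltac:(lra)) as [Hup _].
  assert (Hb : 0 < Re (a t 2%nat) * Rpower t (2 / k ^ 2 + eps) < m).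
  { split; [apply Rmult_lt_0_compat; [trivial|apply exp_pos]|].
    replace (2 / k ^ 2 + eps) with (al + (2 / k ^ 2 + eps - al)) by ring.
    rewrite Rpower_plus, <- Rmult_assoc.
    apply Rle_lt_trans with (M * Rpower t (2 / k ^ 2 + eps - al)).
    - apply Rmult_le_compat_r; [apply Rlt_le, exp_pos|trivial].
    - replace (pos m) with (M * (m / M)) by (field; lra).
      apply Rmult_lt_compat_l; [trivial|apply Hsmall; lra]. }
  apply Hm; revert Hb; generalize (Rpower t (2 / k ^ 2 + eps)); intros x Hb.
  split; unfold ball; simpl; unfold AbsRing_ball, abs, minus, plus, opp; simpl;
    unfold Re, Im in *; rewrite Him.
  - match goal with |- Rabs ?y < _ =>
      replace y with (fst (a t 2%nat) * x) by ring end.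
    rewrite Rabs_pos_eq; lra.
  - match goal with |- Rabs ?y < _ => replace y with 0 by ring end.
    rewrite Rabs_R0; apply cond_pos.
Qed.

(** Now al > 2 / k^2 - eps and a_2 t^al is at least its value M > 0 at t0; dividing by the surplus
    power of t gives divergence. *)
Lemma a2_power_to_infty (eps : R) :
  0 < eps ->
  filterlim (fun t => Cmod (a t 2%nat * RtoC (Rpower t (2 / k ^ 2 - eps)))%C)
    (at_right 0) (Rbar_locally p_infty).
Proof.
  intros Heps; destruct (exponents_near k eps Hk Heps) as [e [He [_ Hal]]].
  destruct (a2_power_monotone e He) as [t0 [Ht0 Hmono]].
  set (al := 2 / (k + 3 * e) ^ 2) in *.
  set (M := Re (a t0 2%nat) * Rpower t0 al) in *.
  assert (HM : 0 < M).
  { apply Rmult_lt_0_compat; [apply a2_pos; lra|apply exp_pos]. }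
  intros P [m Hm].
  (* The threshold m may be negative; |m| + 1 is a positive one above it. *)
  assert (Hm1 : 0 < Rabs m + 1) by (generalize (Rabs_pos m); lra).
  destruct (Rpower_lt_near_0 (al - (2 / k ^ 2 - eps)) (M / (Rabs m + 1)))
    as [d [Hd Hsmall]].
  { lra. }
  { now apply Rdiv_lt_0_compat. }
  apply at_right_0_intro with (Rmin d t0); [apply Rmin_glb_lt; lra|].
  intros t Ht; generalize (Rmin_l d t0) (Rmin_r d t0); intros Hl Hr.
  destruct (a2_pos t ltac:(lra)) as [Hre _].
  destruct (Hmono t ltac:(lra)) as [_ Hlow].
  apply Hm; rewrite Cmod_mult, Cmod_R.
  rewrite (Rabs_pos_eq (Rpower _ _)) by apply Rlt_le, exp_pos.
  apply Rlt_le_trans with (Re (a t 2%nat) * Rpower t (2 / k ^ 2 - eps)).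
  2:{ apply Rmult_le_compat_r; [apply Rlt_le, exp_pos|].
    eapply Rle_trans; [apply Rle_abs|apply re_le_Cmod]. }
  set (be := al - (2 / k ^ 2 - eps)) in *.
  assert (Hbe : 0 < Rpower t be) by apply exp_pos.
  apply (Rmult_lt_reg_r (Rpower t be)); [trivial|].
  rewrite Rmult_assoc, <- Rpower_plus.
  replace (2 / k ^ 2 - eps + be) with al by (unfold be; ring).
  apply Rlt_le_trans with M; [|trivial].
  apply Rle_lt_trans with ((Rabs m + 1) * Rpower t be).
  - apply Rmult_le_compat_r; [lra|generalize (Rle_abs m); lra].
  - replace M with ((Rabs m + 1) * (M / (Rabs m + 1))) by (field; lra).
    apply Rmult_lt_compat_l; [trivial|apply Hsmall; lra].
Qed.

End Coefficient.

Lemma sqrt_asymptotics_minus (f g : R -> R) (b c : R) :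
  filterlim (fun t => f t / sqrt t) (at_right 0) (locally b) ->
  filterlim (fun t => g t / sqrt t) (at_right 0) (locally c) ->
  forall e, 0 < e -> exists d, 0 < d /\ forall t, 0 < t < d ->
    Rabs (f t - g t - (b - c) * sqrt t) <= e * sqrt t.
Proof.
  intros Hb Hc e He.
  destruct (at_right_0_elim _ _ Hb (e / 2)) as [d1 [Hd1 H1]]; [lra|].
  destruct (at_right_0_elim _ _ Hc (e / 2)) as [d2 [Hd2 H2]]; [lra|].
  exists (Rmin d1 d2); split; [now apply Rmin_glb_lt|]; intros t Ht.
  generalize (Rmin_l d1 d2) (Rmin_r d1 d2); intros Hl Hr.
  assert (Hs : 0 < sqrt t) by (apply sqrt_lt_R0; lra).
  replace (f t - g t - (b - c) * sqrt t)
    with ((f t / sqrt t - b - (g t / sqrt t - c)) * sqrt t) by (field; lra).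
  rewrite Rabs_mult, (Rabs_pos_eq (sqrt t)) by lra.
  apply Rmult_le_compat_r; [lra|].
  generalize (H1 t ltac:(lra)) (H2 t ltac:(lra)); intros H3 H4.
  apply Rabs_def2 in H3; apply Rabs_def2 in H4.
  apply Rabs_le_between; lra.
Qed.

Theorem theorem3 (T : R) (lam : R -> R) (gamma : R -> C) (h : C -> R -> C)
    (hminus hplus : R -> R) (a : R -> nat -> C) (b c : R)
    (HT : 0 < T)
    (Hlip : Lip_half T lam)
    (Hslit : generates_slit_maps T lam gamma h)
    (Hanalytic : symmetric_analytic_curve T gamma)
    (Hminus : forall t, 0 < t <= T -> left_image gamma h t (hminus t))
    (Hplus : forall t, 0 < t <= T -> right_image gamma h t (hplus t))
    (Honto : forall t, 0 < t <= T ->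
       symmetric_slit_mapped_onto gamma h t (hminus t) (hplus t))
    (Hc : filterlim (fun t => lam t / sqrt t) (at_right 0) (locally c))
    (Hb : filterlim (fun t => hplus t / sqrt t) (at_right 0) (locally b))
    (Hcb : c < b <= (c + sqrt (c ^ 2 + 16)) / 2)
    (Ha : forall t, 0 < t <= T -> right_expansion gamma h t (hplus t) (a t)) :
  forall eps : R, 0 < eps ->
    filterlim
      (fun t : R => (a t 2%nat * RtoC (Rpower t (2 / (b - c) ^ 2 + eps)))%C)
      (at_right 0) (locally (RtoC 0)) /\
    filterlim
      (fun t : R =>
         Cmod (a t 2%nat * RtoC (Rpower t (2 / (b - c) ^ 2 - eps)))%C)
      (at_right 0) (Rbar_locally p_infty).
Proof.
  assert (Hlim := sqrt_asymptotics_minus _ _ _ _ Hb Hc).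
  intros eps Heps; split.
  - now apply (a2_power_to_0 T lam gamma h hplus a (b - c)); try lra.
  - now apply (a2_power_to_infty T lam gamma h hplus a (b - c)); try lra.
Qed.
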